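(* Let $(p_n)_{n=1}^\infty$ and $(q_n)_{n=1}^\infty$ be two sequences of polynomials with complex coefficients such that $\deg p_n=\deg q_n=n$ for every $n$, and such that all zeros of all $p_n$ and all $q_n$ are uniformly bounded. Assume that all finite limits $$\lim_{n\to\infty}m_k(p_n)=\alpha_k\in\mathbb C,\qquad \lim_{n\to\infty}m_k(q_n)=\beta_k\in\mathbb C,\qquad k=0,1,2,\dots$$ exist. Then: (i) all moments of the sequence $(p_n\boxplus_nq_n)_{n\ge1}$ have finite limits $\gamma_k=\lim_{n\to\infty}m_k(p_n\boxplus_nq_n)\in\mathbb C$, $k=0,1,2,\dots$, and the $R$-transform associated with the sequence $(\gamma_k)$ satisfies $$\mathcal R_\gamma(z)=\mathcal R_\alpha(z)+\mathcal R_\beta(z).$$ (ii) all moments of the sequence $(p_n\boxtimes_nq_n)_{n\ge1}$ have finite limits $\theta_k=\lim_{n\to\infty}m_k(p_n\boxtimes_nq_n)\in\mathbb C$, $k=0,1,2,\dots$, and the $S$-transform associated with the sequence $(\theta_k)$ satisfies $$\mathcal S_\theta(z)=\mathcal S_\alpha(z)\mathcal S_\beta(z)$$ (whenever $\mathcal S_\alpha$ and $\mathcal S_\beta$ exist, i.e. when $\alpha_1\ne0$ and $\beta_1\neq0$).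
   Context: For a polynomial $p$ of degree $n$ with zeros $\lambda_1,\dots,\lambda_n\in\mathbb C$ (with multiplicity), its moments are $m_k(p)=\frac1n\sum_{j=1}^n\lambda_j^k$, $k=0,1,2,\dots$. Finite free convolutions: for polynomials of degree at most $n$ written $p(x)=\sum_{j=0}^n x^{n-j}(-1)^je_j(p)$, $q(x)=\sum_{j=0}^n x^{n-j}(-1)^je_j(q)$, the polynomials $p\boxtimes_n q$ and $p\boxplus_n q$ (written in the same form) are defined by $$e_k(p\boxtimes_n q)=\binom nk^{-1}e_k(p)e_k(q),\qquad e_k(p\boxplus_n q)=(n)^{\underline{k}}\sum_{i+j=k}\frac{e_i(p)}{(n)^{\underline{i}}}\frac{e_j(q)}{(n)^{\underline{j}}},$$ with $(n)^{\underline{k}}=n(n-1)\cdots(n-k+1)$, $(n)^{\underline 0}=1$. Transforms of a complex sequence $\mu=(m_k)_{k\ge0}$ with $m_0=1$, as formal power series: $\mathcal M_\mu(z)=\sum_{k\ge1}m_kz^k$; the $R$-transform $\mathcal R_\mu$ is the formal power series determined by $(z\mathcal M_\mu(z)+z)\,\mathcal R_\mu(z\mathcal M_\mu(z)+z)=\mathcal M_\mu(z)$; the $S$-transform is $\mathcal S_\mu(w)=\frac{w+1}{w}\mathcal M_\mu^{-1}(w)$, where $\mathcal M_\mu^{-1}$ is the compositional inverse of $\mathcal M_\mu$ (it exists when $m_1\neq0$). All identities are between formal power series. *)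

(* Defs.v *)
From HB Require Import structures.
From mathcomp Require Import all_boot all_order all_algebra.
From mathcomp Require Import all_classical.

Set Implicit Arguments.
Unset Strict Implicit.
Unset Printing Implicit Defensive.

Import Order.TTheory GRing.Theory Num.Theory.

Local Open Scope classical_set_scope.
Local Open Scope ring_scope.

(* Formal power series; the coercion gives the coefficients.  A record is used
   because bare functions nat -> F already carry the pointwise product. *)
Record fps (F : Type) := Fps { fps_coef :> nat -> F }.

HB.instance Definition _ (F : Type) := gen_eqMixin (fps F).
HB.instance Definition _ (F : Type) := gen_choiceMixin (fps F).

Lemma fps_ext (F : Type) (f g : fps F) : (forall n, f n = g n) -> f = g.
Proof. by case: f g => [f] [g] /= fg; congr Fps; apply/funext. Qed.

Section FpsRing.
Variable F : comNzRingType.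
Implicit Types f g h : fps F.

Definition fps_zero : fps F := Fps (fun=> 0).
Definition fps_one : fps F := Fps (fun n => (n == 0%N)%:R).
Definition fps_opp f : fps F := Fps (fun n => - f n).
Definition fps_add f g : fps F := Fps (fun n => f n + g n).
Definition fps_mul f g : fps F := Fps (fun n => \sum_(i < n.+1) f i * g (n - i)%N).

Fact fps_addA : associative fps_add.
Proof. by move=> f g h; apply: fps_ext => n /=; rewrite addrA. Qed.
Fact fps_addC : commutative fps_add.
Proof. by move=> f g; apply: fps_ext => n /=; rewrite addrC. Qed.
Fact fps_add0 : left_id fps_zero fps_add.
Proof. by move=> f; apply: fps_ext => n /=; rewrite add0r. Qed.
Fact fps_addN : left_inverse fps_zero fps_opp fps_add.
Proof. by move=> f; apply: fps_ext => n /=; rewrite addNr. Qed.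

HB.instance Definition _ :=
  GRing.isZmodule.Build (fps F) fps_addA fps_addC fps_add0 fps_addN.

(* Ring identities are transported from {poly F} by truncation. *)
Definition fps_agree (n : nat) f (P : {poly F}) := forall k, (k <= n)%N -> f k = P`_k.

Definition fps_trunc (n : nat) f : {poly F} := \poly_(i < n.+1) f i.

Lemma agree_trunc n f : fps_agree n f (fps_trunc n f).
Proof. by move=> k kn; rewrite coef_poly ltnS kn. Qed.

Lemma agree_fps_mul n f g P Q :
  fps_agree n f P -> fps_agree n g Q -> fps_agree n (fps_mul f g) (P * Q).
Proof.
move=> fP gQ k kn /=; rewrite coefM; apply: eq_bigr => i _.
by rewrite fP ?gQ // (leq_trans _ kn) ?leq_subr // -ltnS.
Qed.

Lemma agree_fps_one n : fps_agree n fps_one 1.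
Proof. by move=> k _; rewrite coef1. Qed.

Lemma agree_add n f g P Q :
  fps_agree n f P -> fps_agree n g Q -> fps_agree n (f + g) (P + Q).
Proof. by move=> fP gQ k kn; rewrite coefD -fP // -gQ. Qed.

Lemma agree_eq f g :
  (forall n, exists2 P, fps_agree n f P & fps_agree n g P) -> f = g.
Proof. by move=> fg; apply: fps_ext => n; have [P -> // ->] := fg n. Qed.

Fact fps_mulA : associative fps_mul.
Proof.
move=> f g h; apply: agree_eq => n.
exists (fps_trunc n f * (fps_trunc n g * fps_trunc n h)).
  by do ?[apply: agree_fps_mul]; exact: agree_trunc.
by rewrite mulrA; do ?[apply: agree_fps_mul]; exact: agree_trunc.
Qed.

Fact fps_mulC : commutative fps_mul.
Proof.
move=> f g; apply: agree_eq => n; exists (fps_trunc n f * fps_trunc n g);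
  first by apply: agree_fps_mul; exact: agree_trunc.
by rewrite mulrC; apply: agree_fps_mul; exact: agree_trunc.
Qed.

Fact fps_mul1 : left_id fps_one fps_mul.
Proof.
move=> f; apply: agree_eq => n; exists (1 * fps_trunc n f).
  by apply: agree_fps_mul; [exact: agree_fps_one | exact: agree_trunc].
by rewrite mul1r; exact: agree_trunc.
Qed.

Fact fps_mulDl : left_distributive fps_mul fps_add.
Proof.
move=> f g h; apply: fps_ext => n /=; rewrite -big_split /=.
by apply: eq_bigr => i _; rewrite mulrDl.
Qed.

Fact fps_one_neq0 : fps_one != 0 :> fps F.
Proof.
apply/eqP => /(congr1 (fun f : fps F => f 0%N)) /= /eqP.
by rewrite oner_eq0.
Qed.

HB.instance Definition _ := GRing.Zmodule_isComNzRing.Build (fps F)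
  fps_mulA fps_mulC fps_mul1 fps_mulDl fps_one_neq0.

Lemma fps_coefD f g n : (f + g) n = f n + g n. Proof. by []. Qed.

Lemma fps_coefM f g n : (f * g) n = \sum_(i < n.+1) f i * g (n - i)%N.
Proof. by []. Qed.

Definition fps_X : fps F := Fps (fun n => (n == 1%N)%:R).

(* f(g(z)), meaningful when g 0 = 0: then g ^+ k starts in degree k, so the
   n-th coefficient is this finite sum. *)
Definition fps_comp f g : fps F :=
  Fps (fun n => \sum_(k < n.+1) f k * (g ^+ k) n).

(* f(z) / z, for f 0 = 0 *)
Definition fps_divX f : fps F := Fps (fun n => f n.+1).

Lemma agree_mul n f g P Q :
  fps_agree n f P -> fps_agree n g Q -> fps_agree n (f * g) (P * Q).
Proof. exact: agree_fps_mul. Qed.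

Lemma agree_exp n f P k : fps_agree n f P -> fps_agree n (f ^+ k) (P ^+ k).
Proof.
move=> fP; elim: k => [|k IHk]; first exact: agree_fps_one.
by rewrite !exprS; apply: agree_mul.
Qed.

Lemma agree_X n : fps_agree n fps_X 'X.
Proof. by move=> k _; rewrite coefX. Qed.

Lemma coefX_small (P : {poly F}) k n : P`_0 = 0 -> (n < k)%N -> (P ^+ k)`_n = 0.
Proof.
move=> P0 nk; have -> : P = 'X * \poly_(i < (size P).-1) P`_i.+1.
  apply/polyP => -[|i]; rewrite coefXM // coef_poly.
  case: ltnP => // hi; rewrite nth_default //.
  by case: (size P) hi.
by rewrite exprMn coefXnM nk.
Qed.

Lemma agree_comp n f g P Q : g 0%N = 0 ->
  fps_agree n f P -> fps_agree n g Q -> fps_agree n (fps_comp f g) (P \Po Q).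
Proof.
move=> g0 fP gQ k kn /=; have Q0 : Q`_0 = 0 by rewrite -gQ.
rewrite coef_comp_poly.
have -> : \sum_(i < k.+1) f i * (g ^+ i) k = \sum_(i < k.+1) P`_i * (Q ^+ i)`_k.
  apply: eq_bigr => i _; rewrite fP ?(agree_exp i gQ) //.
  by rewrite (leq_trans _ kn) // -ltnS.
rewrite -(big_mkord xpredT (fun i => P`_i * (Q ^+ i)`_k)).
rewrite -(big_mkord xpredT (fun i => P`_i * (Q ^+ i)`_k)).
have h1 : \sum_(0 <= i < maxn (size P) k.+1) P`_i * (Q ^+ i)`_k =
    \sum_(0 <= i < k.+1) P`_i * (Q ^+ i)`_k.
  rewrite (@big_cat_nat _ _ _ k.+1) ?leq_maxr //=.
  rewrite [X in _ + X]big1_seq ?addr0 // => i /=.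
  by rewrite mem_index_iota => /andP[ki _]; rewrite coefX_small ?mulr0.
have h2 : \sum_(0 <= i < maxn (size P) k.+1) P`_i * (Q ^+ i)`_k =
    \sum_(0 <= i < size P) P`_i * (Q ^+ i)`_k.
  rewrite (@big_cat_nat _ _ _ (size P)) ?leq_maxl //=.
  rewrite [X in _ + X]big1_seq ?addr0 // => i /=.
  by rewrite mem_index_iota => /andP[ki _]; rewrite nth_default ?mul0r.
by rewrite -h1.
Qed.

Lemma fps_comp0 f g : (fps_comp f g) 0%N = f 0%N.
Proof. by rewrite /= big_ord_recl big_ord0 addr0 mulr1. Qed.

Lemma fps_compX f : fps_comp f fps_X = f.
Proof.
apply: agree_eq => n; exists (fps_trunc n f \Po 'X).
  by apply: agree_comp => //; [exact: agree_trunc | exact: agree_X].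
by rewrite comp_polyXr; exact: agree_trunc.
Qed.

Lemma fps_Xcomp g : g 0%N = 0 -> fps_comp fps_X g = g.
Proof.
move=> g0; apply: agree_eq => n; exists ('X \Po fps_trunc n g).
  by apply: agree_comp => //; [exact: agree_X | exact: agree_trunc].
by rewrite comp_polyX; exact: agree_trunc.
Qed.

Lemma fps_compM f g h : h 0%N = 0 ->
  fps_comp (f * g) h = fps_comp f h * fps_comp g h.
Proof.
move=> h0; apply: agree_eq => n.
exists ((fps_trunc n f * fps_trunc n g) \Po fps_trunc n h).
  apply: agree_comp => //; last exact: agree_trunc.
  by apply: agree_mul; exact: agree_trunc.
by rewrite comp_polyM; apply: agree_mul; apply: agree_comp => //;
  exact: agree_trunc.
Qed.

Lemma fps_compA f g h : g 0%N = 0 -> h 0%N = 0 ->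
  fps_comp (fps_comp f g) h = fps_comp f (fps_comp g h).
Proof.
move=> g0 h0; apply: agree_eq => n.
exists ((fps_trunc n f \Po fps_trunc n g) \Po fps_trunc n h).
  apply: agree_comp => //; last exact: agree_trunc.
  by apply: agree_comp => //; exact: agree_trunc.
rewrite -comp_polyA; apply: agree_comp.
- by rewrite fps_comp0.
- exact: agree_trunc.
- by apply: agree_comp => //; exact: agree_trunc.
Qed.

Lemma fps_mulX_divX f : f 0%N = 0 -> fps_X * fps_divX f = f.
Proof.
move=> f0; apply: fps_ext => -[|n]; rewrite fps_coefM big_ord_recl /= mul0r add0r.
  by rewrite big_ord0 f0.
rewrite big_ord_recl /= mul1r big1 ?addr0 => [|i _]; last by rewrite mul0r.
by rewrite /bump /= addn0 subSS subn0.
Qed.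

Lemma fps_divX_mulX f : fps_divX (fps_X * f) = f.
Proof.
apply: fps_ext => n; change ((fps_X * f) n.+1 = f n).
rewrite fps_coefM !big_ord_recl /= mul0r add0r mul1r big1 ?addr0.
  by rewrite /bump /= addn0 subSS subn0.
by move=> i _; rewrite mul0r.
Qed.

Lemma fps_exp_diag g k : g 0%N = 0 -> (g ^+ k) k = g 1%N ^+ k.
Proof.
move=> g0; rewrite -(fps_mulX_divX g0) exprMn.
have -> : (fps_X ^+ k * fps_divX g ^+ k) k = (fps_divX g ^+ k) 0%N.
  elim: k (fps_divX g ^+ k) => [|k IHk] h; first by rewrite expr0 mul1r.
  rewrite exprS -mulrA -[RHS]IHk.
  exact: (congr1 (fun f : fps F => f k) (fps_divX_mulX _)).
have -> : (fps_X * fps_divX g) 1%N = fps_divX g 0%N.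
  exact: (congr1 (fun f : fps F => f 0%N) (fps_divX_mulX _)).
elim: k => // k IHk.
by rewrite !exprS fps_coefM big_ord_recl big_ord0 addr0 subn0 IHk.
Qed.

End FpsRing.

Arguments fps_X {F}.

Section Transforms.
Variable F : fieldType.
Implicit Types (f g h r u : fps F) (m : nat -> F).

Definition is_comp_inverse f g :=
  [/\ g 0%N = 0, fps_comp f g = fps_X & fps_comp g f = fps_X].

(* The compositional inverse, for f 0 = 0 and f 1 != 0; otherwise irrelevant. *)
Definition fps_comp_inv f : fps F := xget 0 [set g | is_comp_inverse f g].

Definition moment_series m : fps F := Fps (fun k => if k is 0 then 0 else m k).

Definition is_Rtransform m r :=
  let u := fps_X * moment_series m + fps_X in
  u * fps_comp r u = moment_series m.

Definition Rtransform m : fps F := xget 0 [set r | is_Rtransform m r].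

(* Meaningful for m 1 != 0. *)
Definition Stransform m : fps F :=
  (fps_X + 1) * fps_divX (fps_comp_inv (moment_series m)).

(* g |-> g \o u is triangular with nonzero diagonal. *)
Lemma fps_comp_solve u h : u 0%N = 0 -> u 1%N != 0 ->
  exists f, fps_comp f u = h.
Proof.
move=> u0 u1.
have [f fE] : exists f : nat -> F, forall n,
    f n = (h n - \sum_(k < n) f k * (u ^+ k) n) / u 1%N ^+ n.
  pose step (s : seq F) :=
    rcons s ((h (size s) - \sum_(k < size s) s`_k * (u ^+ k) (size s))
             / u 1%N ^+ size s).
  pose s n := iter n step [::].
  have ss n : size (s n) = n by elim: n => //= n IHn; rewrite size_rcons IHn.
  have sE n k : (k < n)%N -> (s n)`_k = (s k.+1)`_k.
    elim: n => // n IHn; rewrite ltnS leq_eqVlt => /predU1P[->//|kn].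
    by rewrite -IHn //= nth_rcons ss kn.
  exists (fun n => (s n.+1)`_n) => n.
  rewrite {1}/s iterS -/(s n) /step nth_rcons ss ltnn eqxx.
  by congr ((_ - _) / _); apply: eq_bigr => i _; rewrite sE.
exists (Fps f); apply: fps_ext => n /=; rewrite big_ord_recr /= fps_exp_diag //.
by rewrite [f n]fE mulfVK ?expf_neq0 // addrC subrK.
Qed.

Lemma fps_comp_invP f : f 0%N = 0 -> f 1%N != 0 ->
  is_comp_inverse f (fps_comp_inv f).
Proof.
move=> f0 f1; rewrite /fps_comp_inv; case: xgetP => [g _ //|nog].
have [g gf] := fps_comp_solve fps_X f0 f1.
have g0 : g 0%N = 0 by rewrite -(fps_comp0 g f) gf.
have g1 : g 1%N != 0.
  have := congr1 (fun f : fps F => f 1%N) gf.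
  rewrite /= !big_ord_recl big_ord0 g0 mul0r add0r addr0 => /eqP.
  by apply: contraTneq => ->; rewrite mul0r eq_sym oner_eq0.
have [k kg] := fps_comp_solve fps_X g0 g1.
have kf : k = f.
  by rewrite -[k]fps_compX -gf -fps_compA // kg fps_Xcomp.
by case: (nog g); split=> //; rewrite -{1}kf.
Qed.

Lemma is_comp_inverse_uniq f g h : f 0%N = 0 ->
  is_comp_inverse f g -> is_comp_inverse f h -> g = h.
Proof.
move=> f0 [g0 fg gf] [h0 fh hf].
by rewrite -[g]fps_compX -fh -fps_compA // gf fps_Xcomp.
Qed.

Lemma comp_inv_comp f u : u 0%N = 0 -> u 1%N != 0 ->
  fps_comp (fps_comp f u) (fps_comp_inv u) = f.
Proof.
move=> u0 u1; have [v0 uv _] := fps_comp_invP u0 u1.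
by rewrite fps_compA // uv fps_compX.
Qed.

Lemma Rtransform_arg m (u := fps_X * moment_series m + fps_X) :
  u 0%N = 0 /\ u 1%N = 1.
Proof.
rewrite /u !fps_coefD !fps_coefM !big_ord_recl !big_ord0 /=.
by rewrite !(mul0r, mulr0, addr0, add0r).
Qed.

Lemma is_Rtransform_uniq m r r' :
  is_Rtransform m r -> is_Rtransform m r' -> r = r'.
Proof.
pose u := fps_X * moment_series m + fps_X.
have [u0 u1] : u 0%N = 0 /\ u 1%N = 1 := Rtransform_arg m.
rewrite /is_Rtransform -/u => rM r'M; have u1N0 : u 1%N != 0 by rewrite u1 oner_neq0.
have E s : u * fps_comp s u = fps_comp (fps_X * s) u.
  by rewrite fps_compM ?fps_Xcomp.
rewrite -[r]fps_divX_mulX -[r']fps_divX_mulX; congr fps_divX.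
by rewrite -[LHS](comp_inv_comp _ u0 u1N0) -[RHS](comp_inv_comp _ u0 u1N0)
  -!E rM r'M.
Qed.

Lemma RtransformP m : is_Rtransform m (Rtransform m).
Proof.
rewrite /Rtransform; case: xgetP => [r _ //|nor]; exfalso.
pose u := fps_X * moment_series m + fps_X.
have [u0 u1] : u 0%N = 0 /\ u 1%N = 1 := Rtransform_arg m.
have u1N0 : u 1%N != 0 by rewrite u1 oner_neq0.
have [f fu] := fps_comp_solve (moment_series m) u0 u1N0.
have f0 : f 0%N = 0 by rewrite -(fps_comp0 f u) fu.
case: (nor (fps_divX f)); rewrite /= /is_Rtransform -/u.
by rewrite -{1}(fps_Xcomp u0) -fps_compM // fps_mulX_divX.
Qed.

Lemma mulX_Stransform m : m 1%N != 0 ->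
  fps_X * Stransform m = (fps_X + 1) * fps_comp_inv (moment_series m).
Proof.
move=> m1; have [v0 _ _] : is_comp_inverse _ _ :=
  @fps_comp_invP (moment_series m) erefl m1.
by rewrite /Stransform mulrCA fps_mulX_divX.
Qed.

End Transforms.

Section FiniteFree.
Variable C : numClosedFieldType.
Implicit Types p q : {poly C}.

(* The zeros of p != 0 listed with multiplicity, in some order. *)
Definition zeros p : seq C := sval (closed_field_poly_normal p).

Lemma zerosE p : p = lead_coef p *: \prod_(z <- zeros p) ('X - z%:P).
Proof. exact: svalP (closed_field_poly_normal p). Qed.

Lemma size_zeros p : p != 0 -> size (zeros p) = (size p).-1.
Proof.
move=> p0; rewrite [in RHS](zerosE p) size_scale ?lead_coef_eq0 //.
by rewrite size_prod_XsubC.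
Qed.

Definition moment p (k : nat) : C :=
  (size p).-1%:R^-1 * \sum_(z <- zeros p) z ^+ k.

(* e_j(p), where p = \sum_(j <= n) (-1)^j e_j(p) X^(n - j) has degree <= n *)
Definition ecoef (n : nat) p (j : nat) : C := (-1) ^+ j * p`_(n - j).

Definition poly_of_ecoef (n : nat) (e : nat -> C) : {poly C} :=
  \sum_(j < n.+1) ((-1) ^+ j * e j) *: 'X^(n - j).

Definition finfree_mul (n : nat) p q : {poly C} :=
  poly_of_ecoef n (fun k => 'C(n, k)%:R^-1 * ecoef n p k * ecoef n q k).

Definition finfree_add (n : nat) p q : {poly C} :=
  poly_of_ecoef n (fun k => (n ^_ k)%:R *
    \sum_(i < k.+1) ecoef n p i / (n ^_ i)%:R *
                    (ecoef n q (k - i)%N / (n ^_ (k - i))%:R)).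

Lemma ecoef_poly_of (n : nat) (e : nat -> C) j :
  (j <= n)%N -> ecoef n (poly_of_ecoef n e) j = e j.
Proof.
move=> jn; rewrite /ecoef /poly_of_ecoef coef_sum.
rewrite (bigD1 (Ordinal (jn : (j < n.+1)%N))) //= coefZ coefXn eqxx mulr1.
rewrite big1 ?addr0 => [|i /eqP ij].
  by rewrite mulrA -exprD addnn -mul2n exprM sqrrN !expr1n mul1r.
rewrite coefZ coefXn; case: eqP => [nij|]; last by rewrite mulr0.
case: ij; apply/val_inj => /=; have := ltn_ord i; rewrite ltnS => hin.
by rewrite -(subKn jn) nij subKn.
Qed.

Lemma poly_of_ecoefK (n : nat) p :
  (size p <= n.+1)%N -> poly_of_ecoef n (ecoef n p) = p.
Proof.
move=> sp; rewrite /poly_of_ecoef (reindex_inj rev_ord_inj) /=.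
transitivity (\poly_(i < n.+1) p`_i); last first.
  apply/polyP => i; rewrite coef_poly; case: ltnP => // ni.
  by rewrite nth_default // (leq_trans sp).
rewrite poly_def; apply: eq_bigr => i _; have hi : (i <= n)%N by rewrite -ltnS.
rewrite /= subSS subKn // /ecoef subKn // mulrA -exprD addnn -mul2n exprM.
by rewrite sqrrN !expr1n mul1r.
Qed.

End FiniteFree.

(* Main.v *)
Require Import Defs.
From HB Require Import structures.
From mathcomp Require Import all_boot all_order all_algebra.
From mathcomp Require Import all_classical all_reals all_analysis.
From mathcomp Require Import complex ring.

Set Implicit Arguments.
Unset Strict Implicit.
Unset Printing Implicit Defensive.

Import Order.TTheory GRing.Theory Num.Theory.
Import numFieldNormedType.Exports.

Local Open Scope classical_set_scope.
Local Open Scope ring_scope.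

(* Let P(z) = z^n p(1/z), normalised by P(0) = 1, and let M be the moment
   series of p.  Then theta P = - n M P for theta = z d/dz, hence conjugating
   theta / n by P gives V = theta / n - M, which tends to multiplication by - M
   as n grows.

   Additive case: write P_k = A_k (n)_k / n^k.  The convolution multiplies the
   series A, so the coefficients rho of the logarithmic derivative
   - theta A / (n A) add up.  The exact identity M = sum_j rho_j phi_j, with
   phi_0 = 1 and phi_{j+1} = z (1 - V) phi_j, is triangular in rho and in M, and
   phi_j -> (z (1 + M))^j; its limit is the equation of the R-transform.

   Multiplicative case: the convolution multiplies the ratios
   T(k) = - (k+1) P_{k+1} / ((n-k) P_k).  With the Newton expansion
   T(k) = sum_j tau_j (k)_j / n^j, the recursion for P becomes
   M = z (1 - V) (sum_j tau_j V (V - 1/n) ... (V - (j-1)/n)) 1, whose limit is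
   M = z (1 + M) s(- M) with s(w) = 1 / S(- w).  This is triangular only when
   m_1 does not tend to 0; otherwise shift m_1 by t and use that the moments of
   the convolution are polynomials in t of bounded degree. *)

(** Course-of-values recursion, used to solve triangular systems one unknown at a time. Values are
    stored in growing lists; [x0] only fills positions that [step k] ignores. *)
Lemma strong_rec (T : Type) (x0 : T) (step : nat -> (nat -> T) -> T) :
  (forall k f g, (forall i, (i < k)%N -> f i = g i) -> step k f = step k g) ->
  exists f : nat -> T, forall k, f k = step k f.
Proof.
move=> ext; pose next s := rcons s (step (size s) (nth x0 s)).
pose s n := iter n next [::].
have ss n : size (s n) = n by elim: n => //= n IHn; rewrite size_rcons IHn.
have sE n k : (k < n)%N -> nth x0 (s n) k = nth x0 (s k.+1) k.
  elim: n => // n IHn; rewrite ltnS leq_eqVlt => /predU1P[->//|kn].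
  by rewrite -IHn //= nth_rcons ss kn.
exists (fun n => nth x0 (s n.+1) n) => k.
rewrite {1}/s iterS -/(s k) /next nth_rcons ss ltnn eqxx.
by apply: ext => i ik; rewrite sE.
Qed.

(** * Formal power series: Euler operator, cancellation, inverses *)

Section FpsOperators.
Variable K : fieldType.
Implicit Types (f g h P Q M A : fps K) (c : K).

Lemma fps_coefN f k : (- f) k = - f k. Proof. by []. Qed.

Lemma fps_coef_sum (I : Type) (r : seq I) (G : I -> fps K) k :
  (\sum_(i <- r) G i) k = \sum_(i <- r) G i k.
Proof. by elim/big_rec2: _ => //= i x y _ <-. Qed.

Definition fps_const c : fps K := Fps (fun k => if k is 0 then c else 0).

Lemma fps_coefCM c f k : (fps_const c * f) k = c * f k.
Proof.
rewrite fps_coefM big_ord_recl subn0 big1 ?addr0 // => i _.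
by rewrite /= mul0r.
Qed.

Lemma fps_coefXM f k : (fps_X * f) k = if k is k'.+1 then f k' else 0.
Proof.
case: k => [|k]; first by rewrite fps_coefM big_ord1 mul0r.
exact: (congr1 (fun f : fps K => f k) (fps_divX_mulX f)).
Qed.

Lemma fps_coefM0 f g : (f * g) 0%N = f 0%N * g 0%N.
Proof. by rewrite fps_coefM big_ord1. Qed.

Lemma fps_constM c d : fps_const (c * d) = fps_const c * fps_const d.
Proof. by apply: fps_ext => -[|k]; rewrite fps_coefCM //= mulr0. Qed.

Lemma fps_const1 : fps_const 1 = 1.
Proof. by apply: fps_ext => -[|k]. Qed.

Definition theta f : fps K := Fps (fun k => k%:R * f k).

Lemma fps_coef_theta f k : theta f k = k%:R * f k. Proof. by []. Qed.

Lemma thetaM f g : theta (f * g) = theta f * g + f * theta g.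
Proof.
apply: fps_ext => k; rewrite fps_coefD /= mulr_sumr -big_split /=.
apply: eq_bigr => i _; have ik : (i <= k)%N by rewrite -ltnS.
rewrite -{1}(subnKC ik) natrD; ring.
Qed.

(** In each degree the newest unknown is multiplied by the nonzero constant term of [P]. The
    truncated form serves identities known only in finitely many degrees. *)
Lemma fps_mulI_upto N P f g : P 0%N != 0 ->
  (forall k, (k <= N)%N -> (P * f) k = (P * g) k) ->
  forall k, (k <= N)%N -> f k = g k.
Proof.
move=> P0 E k; elim/ltn_ind: k => k IHk kN.
have := E k kN; rewrite [P * f]mulrC [P * g]mulrC !fps_coefM !big_ord_recr /=.
rewrite subnn (eq_bigr (fun i : 'I_k => g i * P (k - i)%N)); last first.
  by move=> i _; rewrite IHk // (leq_trans (ltnW (ltn_ord i)) kN).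
by move=> /addrI /(mulIf P0).
Qed.

Lemma fps_mulI P f g : P 0%N != 0 -> P * f = P * g -> f = g.
Proof.
move=> P0 E; apply: fps_ext => k.
by apply: (@fps_mulI_upto k P) => // i _; rewrite E.
Qed.

Lemma fps_compD f g h : fps_comp (f + g) h = fps_comp f h + fps_comp g h.
Proof.
apply: fps_ext => k /=; rewrite -big_split /=.
by apply: eq_bigr => i _; rewrite mulrDl.
Qed.

Lemma fps_comp1 h : fps_comp 1 h = 1.
Proof.
apply: fps_ext => k /=; rewrite big_ord_recl mul1r expr0 big1 ?addr0 // => i _.
by rewrite /= mul0r.
Qed.

Lemma fps_compN f h : fps_comp (- f) h = - fps_comp f h.
Proof.
by apply: fps_ext => k /=; rewrite -sumrN; apply: eq_bigr => i _; rewrite mulNr.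
Qed.

(** The inverse is 1/f(0) times the geometric series evaluated at [h] = 1 - f/f(0), which has no
    constant term. *)
Lemma fps_inv_exists f : f 0%N != 0 -> exists g, f * g = 1.
Proof.
move=> f0; pose h : fps K := 1 - fps_const (f 0%N)^-1 * f.
have h0 : h 0%N = 0 by rewrite fps_coefD fps_coefN fps_coefCM mulVf // subrr.
pose geom : fps K := Fps (fun=> 1).
have E : (1 - fps_X) * geom = 1.
  apply: fps_ext => k; rewrite mulrBl mul1r fps_coefD fps_coefN fps_coefXM.
  by case: k => [|k] /=; rewrite ?subr0 ?subrr.
exists (fps_const (f 0%N)^-1 * fps_comp geom h).
have := congr1 (fun g : fps K => fps_comp g h) E; rewrite /= fps_compM // fps_compD fps_compN.
rewrite fps_comp1 fps_Xcomp // => <-; rewrite /h; ring.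
Qed.

Lemma fps_exp0 f k j : f 0%N = 0 -> (k < j)%N -> (f ^+ j) k = 0.
Proof.
move=> f0 kj; rewrite -(fps_mulX_divX f0) exprMn; move: (fps_divX f ^+ j) => g.
elim: j k kj => // j IHj [|k] kj; rewrite exprS -mulrA fps_coefXM //.
exact: IHj.
Qed.

End FpsOperators.

(** * Logarithmic derivatives and conjugated operators *)

Section LogDerivative.
Variable K : numFieldType.
Implicit Types (f g P Q M A rho : fps K) (n : nat).

(** For a reversed polynomial these are Newton's identities, with [M] the moment series. The same
    relation links the series A to its cumulants rho. *)
Definition logd n P M :=
  P 0%N = 1 /\ theta P = - (fps_const n%:R * M * P).

(* The conjugates by P of theta / n and of 1 - theta / n. *)
Definition vop n M f : fps K := fps_const n%:R^-1 * theta f - M * f.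
Definition wop n M f : fps K := f - vop n M f.

Lemma natr_neq0 n : (0 < n)%N -> n%:R != 0 :> K.
Proof. by rewrite pnatr_eq0 -lt0n. Qed.

Lemma logd_coef n P M k : logd n P M ->
  k%:R * P k = - (n%:R * (M * P) k).
Proof.
by case=> _ /(congr1 (fun f : fps K => f k)); rewrite fps_coefN -mulrA fps_coefCM.
Qed.

Lemma logd_coef0 n P M : (0 < n)%N -> logd n P M -> M 0%N = 0.
Proof.
move=> n0 PM; have := logd_coef 0 PM; rewrite mul0r fps_coefM0 PM.1 mulr1.
by move/esym/eqP; rewrite oppr_eq0 mulf_eq0 (negbTE (natr_neq0 n0)) /= => /eqP.
Qed.

Lemma logd_vop n P M f : (0 < n)%N -> logd n P M ->
  P * vop n M f = fps_const n%:R^-1 * theta (P * f).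
Proof.
move=> n0 [_ tP]; rewrite thetaM tP /vop.
have E : fps_const n%:R^-1 * fps_const n%:R = 1 :> fps K.
  by rewrite -fps_constM mulVf ?natr_neq0 ?fps_const1.
transitivity (fps_const n%:R^-1 * (P * theta f) -
  fps_const n%:R^-1 * fps_const n%:R * M * P * f); last by ring.
rewrite E; ring.
Qed.

(** Conjugation by [P] makes the operator diagonal on coefficients, so its iterates can be computed
    explicitly. *)
Lemma logd_coef_wop n P M f k : (0 < n)%N -> logd n P M ->
  (P * wop n M f) k = (1 - k%:R / n%:R) * (P * f) k.
Proof.
move=> n0 PM; rewrite mulrBr logd_vop // fps_coefD fps_coefN fps_coefCM fps_coef_theta.
by field; rewrite natr_neq0.
Qed.

Lemma logd_exists_log n P : (0 < n)%N -> P 0%N = 1 -> exists M, logd n P M.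
Proof.
move=> n0 P0; have [|g Pg] := @fps_inv_exists _ P; first by rewrite P0 oner_neq0.
exists (- fps_const n%:R^-1 * theta P * g); split=> //.
transitivity (fps_const n%:R * fps_const n%:R^-1 * theta P * (P * g)); last by ring.
by rewrite Pg -fps_constM mulfV ?natr_neq0 ?fps_const1 // mul1r mulr1.
Qed.

Lemma logd_rec n P M k : logd n P M -> M 0%N = 0 ->
  P k.+1 = - (n%:R / k.+1%:R * \sum_(i < k.+1) M i.+1 * P (k - i)%N).
Proof.
move=> PM M0; have := logd_coef k.+1 PM.
rewrite fps_coefM big_ord_recl M0 mul0r add0r => E.
have k0 : k.+1%:R != 0 :> K by rewrite natr_neq0.
apply: (mulfI k0); rewrite E.
rewrite (eq_bigr (fun i : 'I_k.+1 => M i.+1 * P (k - i)%N)) //.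
by rewrite mulrN mulrA [k.+1%:R * _]mulrC divfK.
Qed.

(** The recursion solves the identity in degree k + 1 for the coefficient of that degree; it
    computes exp(- n int M/z) without integrating. *)
Lemma logd_exists_exp n M : M 0%N = 0 -> exists P, logd n P M.
Proof.
move=> M0; pose step k (P : nat -> K) := if k is k'.+1 then
  - (n%:R / k'.+1%:R * \sum_(i < k'.+1) M i.+1 * P (k' - i)%N) else 1.
have [|P PE] := @strong_rec _ 0 step.
  move=> [|k] f g fg //=; congr (- (_ * _)); apply: eq_bigr => i _.
  by rewrite fg // ltnS leq_subr.
exists (Fps P); split; first exact: PE.
apply: fps_ext => -[|k].
  by rewrite fps_coefN -mulrA fps_coefCM fps_coefM0 M0 mul0r mulr0 oppr0 /= mul0r.
rewrite fps_coefN -mulrA fps_coefCM /= {1}PE /= [in RHS]big_ord_recl M0 mul0r add0r.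
rewrite [in RHS](eq_bigr (fun i : 'I_k.+1 => M i.+1 * P (k - i)%N)) //.
by rewrite mulrN mulrA [k.+1%:R * _]mulrC divfK ?natr_neq0.
Qed.

Lemma logdM n P P' M M' : logd n P M -> logd n P' M' -> logd n (P * P') (M + M').
Proof.
move=> [P0 PM] [P0' PM']; split; first by rewrite fps_coefM0 P0 P0' mulr1.
rewrite thetaM PM PM'; ring.
Qed.

(** For n > 0 this is (n)_k / n^k, written as a product whose factors each tend to 1. *)
Definition ffac_ratio n k : K := \prod_(i < k) (1 - i%:R / n%:R).

Fixpoint phi n M j : fps K :=
  if j is j'.+1 then fps_X * wop n M (phi n M j') else 1.

Lemma phi_small n M j k : (k < j)%N -> phi n M j k = 0.
Proof.
elim: j k => // j IHj [|k] kj; rewrite [phi _ _ _]/= fps_coefXM //.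
rewrite fps_coefD !(fps_coefN, fps_coefD) fps_coefCM fps_coef_theta IHj // fps_coefM.
rewrite big1 ?(mulr0, subr0, oppr0) // => i _.
by rewrite IHj ?mulr0 // (leq_ltn_trans (leq_subr _ _)).
Qed.

(** This is the pivot of the triangular system for the cumulants; it tends to 1, hence is invertible
    for large n. *)
Lemma phi_diag n M k : M 0%N = 0 -> phi n M k k = ffac_ratio n k.
Proof.
move=> M0; elim: k => [|k IHk]; first by rewrite /ffac_ratio big_ord0.
rewrite [phi _ _ _]/= fps_coefXM !(fps_coefN, fps_coefD) fps_coefCM fps_coef_theta IHk fps_coefM.
rewrite big_ord_recl M0 mul0r add0r big1 => [|i _].
  by rewrite /ffac_ratio big_ord_recr /=; ring.
by rewrite phi_small ?mulr0 // lift0 ltn_subrL (leq_trans _ (ltn_ord i)).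
Qed.

(** Each step z (1 - V) shifts the index of [A] only: the factor 1 - k/n from [logd_coef_wop] turns
    (n)_k / n^k into (n)_{k+1} / n^{k+1}. *)
Lemma logd_mul_phi n P A M j k : (0 < n)%N -> logd n P M ->
  (forall k, P k = A k * ffac_ratio n k) ->
  (P * phi n M j) k = if (j <= k)%N then A (k - j)%N * ffac_ratio n k else 0.
Proof.
move=> n0 PM PA; elim: j k => [|j IHj] k; first by rewrite mulr1 subn0 PA.
rewrite [phi _ _ _]/= mulrCA fps_coefXM; case: k => [|k] //; rewrite logd_coef_wop // IHj.
rewrite ltnS subSS; case: leqP => _; last by rewrite mulr0.
by rewrite /ffac_ratio big_ord_recr /= mulrCA [X in _ * X]mulrC.
Qed.

(** Multiply by [P] and compare coefficients. The left side becomes - (i/n) P_i, that is (rho A)_i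
    (n)_i / n^i, and [logd_mul_phi] produces the same Cauchy product on the right. *)
Lemma moments_from_cumulants n N P A M rho k : (0 < n)%N ->
  logd n P M -> logd n A rho -> (forall k, P k = A k * ffac_ratio n k) ->
  (k <= N)%N -> M k = \sum_(j < N.+1) rho j * phi n M j k.
Proof.
move=> n0 PM Arho PA kN.
have P0 : P 0%N != 0 by rewrite PM.1 oner_neq0.
pose S : fps K := \sum_(j < N.+1) fps_const (rho j) * phi n M j.
suff E i : (i <= N)%N -> (P * M) i = (P * S) i.
  rewrite (fps_mulI_upto P0 E kN) /S fps_coef_sum.
  by apply: eq_bigr => j _; rewrite fps_coefCM.
move=> {k}{kN} iN; rewrite /S mulr_sumr fps_coef_sum.
have E1 : (P * M) i = (rho * A) i * ffac_ratio n i.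
  apply: (mulfI (natr_neq0 n0)); apply: oppr_inj.
  by rewrite mulrC [P * M]mulrC mulrC -logd_coef // mulrA -mulNr -logd_coef // PA mulrA.
rewrite E1 fps_coefM mulr_suml.
rewrite (big_ord_widen N.+1 (fun j : nat => rho j * A (i - j)%N * ffac_ratio n i)) //.
rewrite big_mkcond; apply: eq_bigr => j _.
rewrite mulrCA fps_coefCM (logd_mul_phi _ _ n0 PM PA) ltnS.
by case: leqP => _; rewrite ?mulr0 // mulrA.
Qed.

(* V (V - 1/n) ... (V - (i-1)/n) f, the conjugate by P of (theta)_i / n^i. *)
Fixpoint ffop n M i f : fps K :=
  if i is i'.+1 then
    vop n M (ffop n M i' f) - fps_const (i'%:R / n%:R) * ffop n M i' f
  else f.

Lemma logd_coef_ffop n P M i f k : (0 < n)%N -> logd n P M ->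
  (P * ffop n M i f) k = (k ^_ i)%:R / n%:R ^+ i * (P * f) k.
Proof.
move=> n0 PM; elim: i => [|i IHi]; first by rewrite expr0 divr1 mul1r.
rewrite [ffop _ _ _ _]/= mulrBr logd_vop // fps_coefD fps_coefN mulrCA !fps_coefCM fps_coef_theta IHi.
have nz := natr_neq0 n0.
case: (leqP i k) => ik; last first.
  by rewrite (ffact_small ik) (ffact_small (ltnW ik : (k < i.+1)%N)) !mul0r !mulr0 subr0.
rewrite ffactnSr natrM natrB // exprS.
by field; rewrite expf_neq0.
Qed.

(** After conjugation this is the vanishing of (k)_i for k < i. Powers of V without the shifts by
    multiples of 1/n would in general lack it. *)
Lemma ffop_small n P M i f k : (0 < n)%N -> logd n P M -> (k < i)%N ->
  ffop n M i f k = 0.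
Proof.
move=> n0 PM ki; have P0 : P 0%N != 0 by rewrite PM.1 oner_neq0.
apply: (@fps_mulI_upto _ k P _ 0 P0 _ k (leqnn k)) => j jk.
by rewrite logd_coef_ffop // mulr0 ffact_small ?(leq_ltn_trans jk) // !mul0r.
Qed.

(** Multiplication by [P] replaces each operator by its eigenvalue, so the expansion of the moments
    becomes the Newton expansion of T(k). The ratio is multiplied out because P_k may vanish. *)
Lemma logd_ratio_of_expansion n N P M (tau : nat -> K) : (0 < n)%N -> logd n P M ->
  (forall k, (k <= N)%N ->
     M k.+1 = \sum_(j < N.+1) tau j * wop n M (ffop n M j 1) k) ->
  forall k, (k <= N)%N -> k.+1%:R * P k.+1 =
    - ((n%:R - k%:R) * (\sum_(j < N.+1) tau j * ((k ^_ j)%:R / n%:R ^+ j)) * P k).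
Proof.
move=> n0 PM E k kN; rewrite (logd_coef k.+1 PM).
pose S : fps K := \sum_(j < N.+1) fps_const (tau j) * wop n M (ffop n M j 1).
have -> : (M * P) k.+1 = (P * S) k.
  rewrite fps_coefM big_ord_recl (logd_coef0 n0 PM) mul0r add0r mulrC fps_coefM.
  apply: eq_bigr => i _; rewrite lift0 subSS E ?(leq_trans _ kN) -1?ltnS //.
  rewrite /S fps_coef_sum; congr (_ * _).
  by apply: eq_bigr => j _; rewrite fps_coefCM.
rewrite /S [P * _]mulr_sumr fps_coef_sum !mulr_sumr mulr_suml -!sumrN.
apply: eq_bigr => j _; rewrite mulrCA fps_coefCM logd_coef_wop // logd_coef_ffop //.
rewrite mulr1; have := natr_neq0 n0; move: (k ^_ j)%:R => x nz.
by field; rewrite ?expf_neq0 ?nz.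
Qed.

(** Since the conjugated operators are simultaneously diagonal, composing them multiplies the two
    Newton sums, and no re-expansion of the product is required. *)
Lemma logd_product_expansion n N Q M (tau tau' : nat -> K) : (0 < n)%N -> logd n Q M ->
  (forall k, (k <= N)%N -> k.+1%:R * Q k.+1 =
    - ((n%:R - k%:R) * (\sum_(j < N.+1) tau j * ((k ^_ j)%:R / n%:R ^+ j)) *
       (\sum_(j < N.+1) tau' j * ((k ^_ j)%:R / n%:R ^+ j)) * Q k)) ->
  forall k, (k <= N)%N -> M k.+1 = \sum_(i < N.+1) \sum_(j < N.+1)
    tau i * tau' j * wop n M (ffop n M i (ffop n M j 1)) k.
Proof.
move=> n0 QM E k kN; have Q0 : Q 0%N != 0 by rewrite QM.1 oner_neq0.
have nz := natr_neq0 n0.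
pose S : fps K := \sum_(i < N.+1) \sum_(j < N.+1)
  fps_const (tau i * tau' j) * wop n M (ffop n M i (ffop n M j 1)).
rewrite -[M k.+1]/(fps_divX M k).
suff E' i : (i <= N)%N -> (Q * fps_divX M) i = (Q * S) i.
  rewrite (fps_mulI_upto Q0 E' kN) /S fps_coef_sum; apply: eq_bigr => i _.
  by rewrite fps_coef_sum; apply: eq_bigr => j _; rewrite fps_coefCM.
move=> {k}{kN} iN.
have -> : (Q * fps_divX M) i = (M * Q) i.+1.
  rewrite mulrC -{2}(fps_mulX_divX (logd_coef0 n0 QM)) -mulrA fps_coefXM.
  by [].
apply: (mulfI nz); apply: oppr_inj; rewrite -(logd_coef i.+1 QM) E //.
congr (- _); rewrite /S [Q * _]mulr_sumr fps_coef_sum -mulrA -mulrA mulr_suml !mulr_sumr.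
apply: eq_bigr => a _; rewrite [Q * _]mulr_sumr fps_coef_sum mulr_suml !mulr_sumr.
apply: eq_bigr => b _; rewrite [Q * _]mulrCA fps_coefCM logd_coef_wop //.
rewrite !(logd_coef_ffop _ _ _ n0 QM) mulr1.
move: (i ^_ a)%:R (i ^_ b)%:R => x y.
by field; rewrite ?expf_neq0 ?nz.
Qed.

End LogDerivative.

(** * Reversed polynomials and the finite free convolutions *)

Section ReversedPolynomial.
Variable C : numClosedFieldType.
Implicit Types (p q : {poly C}) (n : nat).

Definition rev_series n p : fps C :=
  Fps (fun k => if (k <= n)%N then p`_(n - k) / p`_n else 0).

Lemma prod_1subX_coef (s : seq C) k :
  (\prod_(z <- s) (1 - fps_const z * fps_X)) k =
  if (k <= size s)%N then (\prod_(z <- s) ('X - z%:P))`_(size s - k) else 0.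
Proof.
elim: s k => [|z s IHs] k.
  by rewrite !big_nil sub0n coef1; case: k.
rewrite !big_cons mulrBl mul1r -mulrA fps_coefD fps_coefN fps_coefCM fps_coefXM.
have IHs' := IHs; rewrite {}IHs; case: k => [|k] /=.
  rewrite mulr0 subr0 !subn0 mulrBl coefB coefXM coefCM /=.
  by rewrite [X in _ - z * X]nth_default ?size_prod_XsubC // mulr0 subr0.
rewrite IHs' subSS mulrBl coefB coefXM coefCM ltnS.
have [ks|sk] := ltnP k (size s).
  by rewrite (ltnW ks) subn_eq0 leqNgt ks /= -subnS.
rewrite sub0r; case: leqP => ks; last by rewrite mulr0 oppr0.
by rewrite (_ : k = size s) ?subnn ?sub0r //; apply/eqP; rewrite eqn_leq ks.
Qed.

(** Newton's identities: a factor 1 - zX contributes its geometric series [G], because theta (1 -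
    zX) = - zX = - G (1 - zX). *)
Lemma theta_prod_1subX (s : seq C) :
  theta (\prod_(z <- s) (1 - fps_const z * fps_X)) =
  - (moment_series (fun k => \sum_(z <- s) z ^+ k)
     * \prod_(z <- s) (1 - fps_const z * fps_X)).
Proof.
elim: s => [|z s IHs].
  rewrite !big_nil mulr1; apply: fps_ext => -[|k] /=; rewrite ?mul0r ?oppr0 //.
  by rewrite mulr0 big_nil oppr0.
rewrite !big_cons thetaM {}IHs; set P := \prod_(_ <- _) _.
set Ms := moment_series (fun k => \sum_(z <- s) z ^+ k).
pose G := moment_series (fun k => z ^+ k).
have -> : moment_series (fun k => \sum_(j <- z :: s) j ^+ k) = G + Ms.
  by apply: fps_ext => -[|k] /=; rewrite ?addr0 // big_cons.
have -> : theta (1 - fps_const z * fps_X) = - (G * (1 - fps_const z * fps_X)).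
  have -> : G * (1 - fps_const z * fps_X) = fps_const z * fps_X.
    apply: fps_ext => k; rewrite mulrC mulrBl mul1r -mulrA fps_coefD fps_coefN.
    rewrite !fps_coefCM fps_coefXM; case: k => [|[|k]] /=.
    - by rewrite mulr0 subr0.
    - by rewrite mulr0 subr0 expr1 mulr1.
    - by rewrite exprS subrr mulr0.
  apply: fps_ext => k.
  rewrite fps_coef_theta fps_coefD !fps_coefN fps_coefCM /=.
  case: k => [|[|k]] /=; rewrite ?(mul0r, mulr0, oppr0, mul1r, mulr1, add0r) //.
ring.
Qed.

Lemma logd_rev_series n p : (0 < n)%N -> size p = n.+1 ->
  logd n (rev_series n p) (moment_series (moment p)).
Proof.
move=> n0 sp; have p0 : p != 0 by rewrite -size_poly_eq0 sp.
have ss : size (zeros p) = n by rewrite size_zeros // sp.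
have lc : lead_coef p = p`_n by rewrite lead_coefE sp.
have lc0 : p`_n != 0 by rewrite -lc lead_coef_eq0.
have -> : rev_series n p = \prod_(z <- zeros p) (1 - fps_const z * fps_X).
  apply: fps_ext => k; rewrite prod_1subX_coef ss /=; case: leqP => // kn.
  by rewrite {1}(zerosE p) coefZ lc mulrC mulKf.
split.
  rewrite prod_1subX_coef subn0 leq0n.
  by move/(congr1 (coefp (size (zeros p)))): (zerosE p);
     rewrite /= ss coefZ lc -[LHS]mulr1 => /(mulfI lc0).
rewrite theta_prod_1subX; congr (- (_ * _)).
apply: fps_ext => k; rewrite fps_coefCM; case: k => [|k] /=; first by rewrite mulr0.
by rewrite /moment sp /= mulVKf ?natr_neq0.
Qed.

Lemma size_poly_of_ecoef n (e : nat -> C) : e 0%N != 0 ->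
  size (poly_of_ecoef n e) = n.+1.
Proof.
move=> e0; apply/eqP; rewrite eqn_leq; apply/andP; split.
  apply: (leq_trans (size_sum _ _ _)); apply/bigmax_leqP => i _.
  by apply: (leq_trans (size_scale_leq _ _)); rewrite size_polyXn ltnS leq_subr.
rewrite ltnNge; apply: contra e0 => /leq_sizeP/(_ n (leqnn n)) c0.
rewrite -(@ecoef_poly_of _ n e 0%N) // /ecoef subn0 c0 mulr0.
by rewrite eqxx.
Qed.

Lemma coef_poly_of_ecoef n (e : nat -> C) k : (k <= n)%N ->
  (poly_of_ecoef n e)`_(n - k) = (-1) ^+ k * e k.
Proof.
move=> kn; rewrite -(@ecoef_poly_of _ n e k kn) /ecoef mulrA -exprD addnn.
by rewrite -mul2n exprM sqrrN !expr1n mul1r.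
Qed.

Lemma lead_poly_of_ecoef n (e : nat -> C) : (poly_of_ecoef n e)`_n = e 0%N.
Proof. by have := @coef_poly_of_ecoef n e 0 (leq0n n); rewrite subn0 mul1r. Qed.

Lemma rev_series_coef n p k : (k <= n)%N -> rev_series n p k = p`_(n - k) / p`_n.
Proof. by move=> kn; rewrite /= kn. Qed.

Lemma ecoef0 n p : ecoef n p 0 = p`_n.
Proof. by rewrite /ecoef subn0 mul1r. Qed.

Section Convolution.
Variables (n : nat) (p q : {poly C}).
Hypotheses (n0 : (0 < n)%N) (sp : size p = n.+1) (sq : size q = n.+1).

Let p0 : p`_n != 0.
Proof. by rewrite -[n]/(n.+1.-1) -sp -lead_coefE lead_coef_eq0 -size_poly_eq0 sp. Qed.

Let q0 : q`_n != 0.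
Proof. by rewrite -[n]/(n.+1.-1) -sq -lead_coefE lead_coef_eq0 -size_poly_eq0 sq. Qed.

Lemma size_finfree_mul : size (finfree_mul n p q) = n.+1.
Proof. by apply: size_poly_of_ecoef; rewrite bin0 !ecoef0 invr1 mul1r mulf_neq0. Qed.

Lemma size_finfree_add : size (finfree_add n p q) = n.+1.
Proof.
apply: size_poly_of_ecoef; rewrite big_ord1 !ecoef0 ffactn0 !divr1 mul1r.
exact: mulf_neq0.
Qed.

Lemma sign_coef_ecoef (r : {poly C}) k : r`_(n - k) = (-1) ^+ k * ecoef n r k.
Proof. by rewrite /ecoef mulrA -exprD addnn -mul2n exprM sqrrN !expr1n mul1r. Qed.

(** Reversed coefficients are (-1)^k e_k / e_0, so a product of two of them lacks one sign. *)
Lemma rev_series_finfree_mul k : (k <= n)%N ->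
  rev_series n (finfree_mul n p q) k * 'C(n, k)%:R =
  (-1) ^+ k * rev_series n p k * rev_series n q k.
Proof.
move=> kn; rewrite !rev_series_coef // lead_poly_of_ecoef coef_poly_of_ecoef //.
rewrite !sign_coef_ecoef bin0 !ecoef0 invr1.
have b0 : 'C(n, k)%:R != 0 :> C by rewrite natr_neq0 // bin_gt0.
have E : (-1) ^+ k * (-1) ^+ k = 1 :> C.
  by rewrite -exprD addnn -mul2n exprM sqrrN !expr1n.
move: ((-1) ^+ k) E => s E.
transitivity (s * (ecoef n p k * ecoef n q k / (p`_n * q`_n))).
  by field; rewrite b0 p0 q0.
rewrite -[s in LHS]mul1r -E; by field; rewrite p0 q0.
Qed.

Lemma ffac_ratioE k : ffac_ratio C n k = (n ^_ k)%:R / n%:R ^+ k.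
Proof.
have nz := natr_neq0 C n0.
elim: k => [|k IHk]; first by rewrite /ffac_ratio big_ord0 ffactn0 divr1.
rewrite /ffac_ratio big_ord_recr /= -/(ffac_ratio C n k) IHk.
case: (leqP k n) => kn; last first.
  by rewrite (ffact_small kn) (ffact_small (ltnW kn : (n < k.+1)%N)) !mul0r.
rewrite ffactnSr natrM natrB // exprS.
by field; rewrite expf_neq0.
Qed.

(** The series A of the additive case, whose logarithmic derivative carries the cumulants. Above
    degree n the quotient is 0/0, which evaluates to 0. *)
Definition cumulant_series (r : {poly C}) : fps C :=
  Fps (fun k => rev_series n r k / ffac_ratio C n k).

Lemma rev_seriesE (r : {poly C}) k :
  rev_series n r k = cumulant_series r k * ffac_ratio C n k.
Proof.
rewrite /cumulant_series /= ffac_ratioE; case: leqP => kn; last by rewrite !mul0r.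
by rewrite divfK // mulf_neq0 ?invr_eq0 ?expf_neq0 ?natr_neq0 // ffact_gt0.
Qed.

(** The falling factorials in the definition of the convolution leave a plain Cauchy product. Above
    degree n that product may be nonzero, and the vanishing of (n)_k truncates it. *)
Lemma rev_series_finfree_add k :
  rev_series n (finfree_add n p q) k =
  (cumulant_series p * cumulant_series q) k * ffac_ratio C n k.
Proof.
have nz := natr_neq0 C n0.
rewrite /= ffac_ratioE; case: leqP => kn; last by rewrite (ffact_small kn) mul0r mulr0.
rewrite lead_poly_of_ecoef coef_poly_of_ecoef // big_ord1 ffactn0 !ecoef0 !divr1 mul1r.
rewrite mulrA !mulr_sumr !mulr_suml; apply: eq_bigr => i _.
have ik : (i <= k)%N by rewrite -ltnS.
rewrite !ffac_ratioE (leq_trans ik kn) (leq_trans (leq_subr i k) kn).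
rewrite !sign_coef_ecoef.
have -> : (-1) ^+ k = (-1) ^+ i * (-1) ^+ (k - i) :> C by rewrite -exprD subnKC.
have -> : n%:R ^+ k = n%:R ^+ i * n%:R ^+ (k - i) :> C by rewrite -exprD subnKC.
have f1 : (n ^_ i)%:R != 0 :> C by rewrite natr_neq0 // ffact_gt0 (leq_trans ik kn).
have f2 : (n ^_ (k - i))%:R != 0 :> C.
  by rewrite natr_neq0 // ffact_gt0 (leq_trans (leq_subr i k) kn).
by field; rewrite p0 q0 f1 f2 !expf_neq0.
Qed.

End Convolution.
End ReversedPolynomial.

(** * Functional equations of the R- and S-transforms *)

Section TransformEquations.
Variable K : fieldType.
Implicit Types (m : nat -> K) (r s : fps K).
Local Notation Ms := moment_series.

Definition cumulant_arg m : fps K := fps_X * (1 + Ms m).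

Lemma fps_comp_Rtransform m :
  fps_comp (fps_X * Rtransform m) (cumulant_arg m) = Ms m.
Proof.
have := RtransformP m; rewrite /is_Rtransform.
have -> : fps_X * Ms m + fps_X = cumulant_arg m by rewrite /cumulant_arg; ring.
have u0 : cumulant_arg m 0%N = 0 by rewrite fps_coefXM.
by rewrite fps_compM // fps_Xcomp.
Qed.

Lemma Rtransform_unique m r :
  fps_comp (fps_X * r) (cumulant_arg m) = Ms m -> Rtransform m = r.
Proof.
move=> E; apply: is_Rtransform_uniq (RtransformP m) _; rewrite /is_Rtransform.
have -> : fps_X * Ms m + fps_X = cumulant_arg m by rewrite /cumulant_arg; ring.
have u0 : cumulant_arg m 0%N = 0 by rewrite fps_coefXM.
by rewrite -[X in X * _](fps_Xcomp u0) -fps_compM.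
Qed.

(* s(w) = 1 / S(- w), with S the S-transform of m. *)
Definition is_inv_Stransform m s :=
  Ms m = fps_X * (1 + Ms m) * fps_comp s (- Ms m).

(** Solve s(- M) = (M/z) / (1 + M) for s; this is possible because - M has a nonzero linear
    coefficient. *)
Lemma inv_Stransform_exists m : m 1%N != 0 -> exists s, is_inv_Stransform m s.
Proof.
move=> m1; have [|g gE] := @fps_inv_exists _ (1 + Ms m).
  by rewrite fps_coefD addr0 oner_neq0.
have [||s sE] := @fps_comp_solve K (- Ms m) (fps_divX (Ms m) * g).
- by rewrite fps_coefN oppr0.
- by rewrite fps_coefN oppr_eq0.
exists s; rewrite /is_inv_Stransform sE.
transitivity (fps_X * fps_divX (Ms m) * ((1 + Ms m) * g)); last by ring.
by rewrite gE mulr1 fps_mulX_divX.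
Qed.

(** Substituting the compositional inverse c of the moment series gives z = c (1 + z) s(- z). Here c
    (1 + z) = z S(z), and z cancels. *)
Lemma inv_StransformP m s : m 1%N != 0 -> is_inv_Stransform m s ->
  Stransform m * fps_comp s (- fps_X) = 1.
Proof.
move=> m1 sE; have [c0 Mc cM] := @fps_comp_invP _ (Ms m) erefl m1.
have E1 (c : fps K) : c 0%N = 0 -> fps_comp (Ms m) c = fps_X ->
    fps_X = c * (1 + fps_X) * fps_comp s (- fps_X).
  move=> {}c0 {}Mc; have := congr1 (fun f : fps K => fps_comp f c) sE.
  have NM0 : (- Ms m) 0%N = 0 by rewrite fps_coefN oppr0.
  rewrite (fps_compM _ _ c0) (fps_compM _ _ c0) fps_compD fps_comp1 (fps_Xcomp c0).
  by rewrite Mc (fps_compA _ NM0 c0) fps_compN Mc.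
have X1 : (fps_divX fps_X : fps K) 0%N != 0 by rewrite /= oner_neq0.
rewrite -[LHS]fps_divX_mulX mulrA (mulX_Stransform m1) [_ + 1]addrC.
by rewrite [(1 + _) * _]mulrC -(E1 _ c0 Mc) -[fps_X]mulr1 fps_divX_mulX.
Qed.

End TransformEquations.

(* A record rather than a plain definition, so that [apply:] does not see
   through it to the underlying inclusion of filters. *)
Record conv (K : numFieldType) (u : nat -> K) (l : K) : Prop :=
  Conv { conv_cvg : u n @[n --> \oo] --> (l : K^o) }.

(** * Limits of scalar sequences *)

Section Convergence.
Variable K : numFieldType.
Implicit Types (u v : nat -> K) (l m : K).

Lemma conv_cst l : conv (fun=> l) l.
Proof. by split; exact: (@cvg_cst K^o). Qed.

Lemma convD u v l m : conv u l -> conv v m -> conv (fun n => u n + v n) (l + m).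
Proof. by move=> [ul] [vm]; split; exact: (@cvgD K K^o). Qed.

Lemma convN u l : conv u l -> conv (fun n => - u n) (- l).
Proof. by move=> [ul]; split; exact: (@cvgN K K^o). Qed.

Lemma convM u v l m : conv u l -> conv v m -> conv (fun n => u n * v n) (l * m).
Proof. by move=> [ul] [vm]; split; exact: (@cvgM K). Qed.

Lemma convV u l : l != 0 -> conv u l -> conv (fun n => (u n)^-1) l^-1.
Proof. by move=> l0 [ul]; split; exact: (@cvgV K). Qed.

Lemma conv_sum (I : Type) (r : seq I) (U : I -> nat -> K) (L : I -> K) :
  (forall i, conv (U i) (L i)) ->
  conv (fun n => \sum_(i <- r) U i n) (\sum_(i <- r) L i).
Proof.
move=> UL; elim: r => [|i r IHr].
  rewrite big_nil (_ : (fun _ => _) = fun=> 0); first exact: conv_cst.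
  by apply/funext => n; rewrite big_nil.
rewrite big_cons (_ : (fun _ => _) = fun n => U i n + \sum_(j <- r) U j n).
  exact: convD.
by apply/funext => n; rewrite big_cons.
Qed.

Lemma conv_near u v l : conv u l ->
  (exists N, forall n, (N <= n)%N -> u n = v n) -> conv v l.
Proof.
move=> [ul] [N uv]; split; move: ul; apply: cvg_trans; apply: near_eq_cvg.
by exists N => // n /= Nn; rewrite uv.
Qed.

Lemma conv_neq0 u l : l != 0 -> conv u l ->
  exists N, forall n, (N <= n)%N -> u n != 0.
Proof.
move=> l0 [ul]; have [N _ NP] := @cvgr_neq0 K K^o nat \oo _ u l ul l0.
by exists N => n Nn; apply: NP.
Qed.

Lemma conv_unique u l m : conv u l -> conv u m -> l = m.
Proof. by move=> [ul] [um]; apply: (@cvg_unique K^o _ (u @ \oo)). Qed.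

Lemma eventually_upto (P : nat -> nat -> Prop) :
  (forall k, exists N, forall n, (N <= n)%N -> P k n) ->
  forall k, exists N, forall n, (N <= n)%N -> forall i, (i <= k)%N -> P i n.
Proof.
move=> H; elim=> [|k [N1 IH]].
  have [N HN] := H 0%N; exists N => n Nn i; rewrite leqn0 => /eqP->; exact: HN.
have [N2 HN] := H k.+1; exists (maxn N1 N2) => n; rewrite geq_max => /andP[n1 n2] i.
by rewrite leq_eqVlt ltnS => /predU1P[->|ik]; [apply: HN | apply: IH].
Qed.

(* G(2t) - 2^d G(t) kills the leading coefficient and multiplies G(0) by
   1 - 2^d. *)
Lemma conv_horner0 (G : nat -> {poly K}) d : (forall n, (size (G n) <= d)%N) ->
  (forall t, t != 0 -> exists l, conv (fun n => (G n).[t]) l) ->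
  exists l, conv (fun n => (G n).[0]) l.
Proof.
elim: d G => [|d IHd] G sG cG.
  exists 0; apply: (conv_near (conv_cst _)); exists 0%N => n _.
  by have := sG n; rewrite leqn0 size_poly_eq0 => /eqP->; rewrite horner0.
(* Constants are treated apart: for degree 0 the factor 1 - 2^0 is zero and the elimination
   fails. *)
case: d IHd sG => [|d] IHd sG.
  have [l cl] := cG 1 (oner_neq0 _); exists l.
  apply: (conv_near cl); exists 0%N => n _.
  by rewrite (size1_polyC (sG n)) !hornerC.
pose H n := \poly_(i < d.+1) ((2 ^+ i - 2 ^+ d.+1) * (G n)`_i).
have HE n t : (H n).[t] = (G n).[2 * t] - 2 ^+ d.+1 * (G n).[t].
  rewrite !(horner_coef_wide _ (sG n)) horner_poly mulr_sumr -sumrB.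
  rewrite [RHS]big_ord_recr /= [X in _ = _ + X](_ : _ = 0) ?addr0; last first.
    by rewrite exprMn; ring.
  by apply: eq_bigr => i _; rewrite exprMn; ring.
have [n|t t0|l cl] := IHd H; first exact: size_poly.
  have [|l1 c1] := cG (2 * t); first by rewrite mulf_neq0 ?pnatr_eq0.
  have [l2 c2] := cG t t0; exists (l1 - 2 ^+ d.+1 * l2).
  rewrite (_ : (fun n => _) = fun n => (G n).[2 * t] - 2 ^+ d.+1 * (G n).[t]).
    by apply: convD => //; apply: convN; apply: convM => //; apply: conv_cst.
  by apply/funext => n; rewrite HE.
have c0 : 1 - 2 ^+ d.+1 != 0 :> K.
  by rewrite subr_eq0 -natrX -[1]/(1%:R) eqr_nat ltn_eqF // (ltn_exp2l 0).
exists ((1 - 2 ^+ d.+1)^-1 * l).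
apply: (conv_near (convM (conv_cst _) cl)); exists 0%N => n _.
by rewrite HE mulr0; field.
Qed.

End Convergence.

(** * Coefficientwise limits of the exact identities *)

Section SeriesConvergence.
Variable K : numFieldType.
(** A number field need not be Archimedean; for the complex numbers this is [conv_invn_complex]. *)
Hypothesis conv_invn : conv (fun n => n%:R^-1 : K) 0.
Local Notation Ms := moment_series.

(** The cut-off N allows limits to be established one degree at a time. *)
Definition conv_upto N (f : nat -> fps K) (l : fps K) :=
  forall k, (k <= N)%N -> conv (fun n => f n k) (l k).

Implicit Types (f M P Q : nat -> fps K) (l m : fps K).

Lemma conv_uptoW N N' f l : (N' <= N)%N -> conv_upto N f l -> conv_upto N' f l.
Proof. by move=> NN fl k kN; apply: fl; apply: leq_trans NN. Qed.

Lemma conv_upto_cst N l : conv_upto N (fun=> l) l.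
Proof. by move=> k _; apply: conv_cst. Qed.

Lemma conv_uptoD N f f' l m : conv_upto N f l -> conv_upto N f' m ->
  conv_upto N (fun n => f n + f' n) (l + m).
Proof. by move=> fl gm k kN; apply: convD; [apply: fl | apply: gm]. Qed.

Lemma conv_uptoN N f l : conv_upto N f l -> conv_upto N (fun n => - f n) (- l).
Proof. by move=> fl k kN; apply: convN; apply: fl. Qed.

Lemma conv_uptoM N f f' l m : conv_upto N f l -> conv_upto N f' m ->
  conv_upto N (fun n => f n * f' n) (l * m).
Proof.
move=> fl gm k kN; apply: conv_sum => i.
by apply: convM; [apply: fl | apply: gm]; rewrite (leq_trans _ kN) ?leq_subr // -ltnS.
Qed.

(** The degree gained here is what makes the systems for the moments triangular. *)
Lemma conv_upto_mulX N f l : conv_upto N f l ->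
  conv_upto N.+1 (fun n => fps_X * f n) (fps_X * l).
Proof.
move=> fl [|k] kN; rewrite fps_coefXM.
  apply: (conv_near (conv_cst _)); exists 0%N => n _; exact/esym/fps_coefXM.
apply: (conv_near (fl k kN)); exists 0%N => n _; exact/esym/fps_coefXM.
Qed.

Lemma conv_upto_vop N M m f l : conv_upto N M m -> conv_upto N f l ->
  conv_upto N (fun n => vop n (M n) (f n)) (- m * l).
Proof.
move=> Mm fl; rewrite -[X in conv_upto _ _ X]add0r mulNr; apply: conv_uptoD.
  move=> k kN; rewrite -[X in conv _ X](mul0r (k%:R * l k)).
  apply: conv_near.
    exact: convM conv_invn (convM (conv_cst k%:R) (fl k kN)).
  by exists 0%N => n _; rewrite fps_coefCM.
by apply: conv_uptoN; apply: conv_uptoM.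
Qed.

Lemma conv_upto_wop N M m f l : conv_upto N M m -> conv_upto N f l ->
  conv_upto N (fun n => wop n (M n) (f n)) ((1 + m) * l).
Proof.
move=> Mm fl; have -> : (1 + m) * l = l - (- m * l) by ring.
by apply: conv_uptoD => //; apply: conv_uptoN; apply: conv_upto_vop.
Qed.

Lemma conv_upto_phi N M m j : conv_upto N M m ->
  conv_upto N.+1 (fun n => phi n (M n) j) ((fps_X * (1 + m)) ^+ j).
Proof.
move=> Mm; elim: j => [|j IHj]; first exact: conv_upto_cst.
rewrite exprS -mulrA; apply: conv_upto_mulX; apply: conv_upto_wop => //.
by apply: conv_uptoW IHj.
Qed.

Lemma conv_upto_ffop N M m f l i : conv_upto N M m -> conv_upto N f l ->
  conv_upto N (fun n => ffop n (M n) i (f n)) ((- m) ^+ i * l).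
Proof.
move=> Mm fl; elim: i => [|i IHi]; first by rewrite mul1r.
rewrite exprS -mulrA -[X in conv_upto _ _ X]subr0; apply: conv_uptoD.
  exact: conv_upto_vop.
apply: conv_uptoN => k kN; rewrite -[X in conv _ X](mul0r (((- m) ^+ i * l) k)).
apply: conv_near.
  apply: convM (IHi k kN).
  rewrite -(mulr0 i%:R); exact: convM (conv_cst i%:R) conv_invn.
by exists 0%N => n _; rewrite fps_coefCM.
Qed.

Lemma conv_ffac_ratio k : conv (fun n => ffac_ratio K n k) 1.
Proof.
elim: k => [|k IHk].
  by apply: (conv_near (conv_cst 1)); exists 0%N => n _; rewrite /ffac_ratio big_ord0.
rewrite -[X in conv _ X](mulr1 1) -[X in _ * X](subr0 1) -(mulr0 k%:R).
apply: conv_near.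
  exact: convM IHk (convD (conv_cst 1) (convN (convM (conv_cst k%:R) conv_invn))).
by exists 0%N => n _; rewrite /ffac_ratio big_ord_recr.
Qed.

(** Induction on the degree. All limits are fixed in advance by choice, with default 0, so that [H]
    always speaks of the same [g]. *)
Lemma conv_upto_exists M :
  (forall n, (0 < n)%N -> M n 0%N = 0) ->
  (forall k g, conv_upto k M (Ms g) -> exists x, conv (fun n => M n k.+1) x) ->
  exists g, forall N, conv_upto N M (Ms g).
Proof.
move=> M0 H; pose g k := xget 0 [set x | conv (fun n => M n k) x]%classic.
exists g => N; elim: N => [|N IHN].
  move=> k; rewrite leqn0 => /eqP->; apply: (conv_near (conv_cst _)).
  by exists 1%N => n n0; rewrite M0.
move=> k; rewrite leq_eqVlt => /predU1P[->|]; last exact: IHN.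
rewrite /= /g; case: xgetP => [l -> //|nol].
by have [l cl] := H _ _ IHN; case: (nol l).
Qed.

(** Solve the triangular system for the cumulants. The pivots tend to 1, and the coefficients of [r]
    solve the limiting system, whose pivots are 1 since [u] starts with z. *)
Lemma cumulants_conv M (rho : nat -> fps K) m (r : fps K) :
  (forall n, (0 < n)%N -> M n 0%N = 0) ->
  (forall n N k, (0 < n)%N -> (k <= N)%N ->
     M n k = \sum_(j < N.+1) rho n j * phi n (M n) j k) ->
  (forall N, conv_upto N M m) -> fps_comp r (fps_X * (1 + m)) = m ->
  forall k, conv (fun n => rho n k) (r k).
Proof.
move=> M0 E Mm rE; have m0 : m 0%N = 0.
  apply: (conv_unique (Mm 0%N 0%N (leqnn _))); apply: (conv_near (conv_cst _)).
  by exists 1%N => n n0; rewrite M0.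
set u := fps_X * (1 + m) in rE.
have u0 : u 0%N = 0 by rewrite fps_coefXM.
have u1 : u 1%N = 1 by rewrite fps_coefXM fps_coefD m0 addr0.
elim/ltn_ind => k IHk.
have rk : r k = (m k - \sum_(j < k) r j * (u ^+ j) k) / 1.
  rewrite -[X in (X - _) / _](congr1 (fun f : fps K => f k) rE) /= big_ord_recr /=.
  by rewrite fps_exp_diag // u1 expr1n divr1 mulr1 addrC addrK.
have c := conv_ffac_ratio k; have [N cN] := conv_neq0 (oner_neq0 K) c.
rewrite rk; apply: conv_near.
  apply: convM (convV (oner_neq0 K) c).
  apply: convD (Mm k k (leqnn k)) (convN _).
  apply: (@conv_sum _ _ _ (fun (j : 'I_k) n => rho n j * phi n (M n) j k)) => j.
  by apply: convM; [exact: IHk | exact: (conv_upto_phi _ (Mm k) (leqnSn k))].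
exists (maxn 1 N) => n; rewrite geq_max => /andP[n0 Nn].
rewrite (E n k k n0 (leqnn k)) big_ord_recr /= phi_diag ?M0 // addrC addrK.
by rewrite mulfK // cN.
Qed.

(** The same system read in the other direction: for every j, the coefficient of phi_j in degree k +
    1 involves only moments up to k. *)
Lemma moments_conv_of_cumulants M (rho : nat -> fps K) (r : fps K) :
  (forall n, (0 < n)%N -> M n 0%N = 0) ->
  (forall n N k, (0 < n)%N -> (k <= N)%N ->
     M n k = \sum_(j < N.+1) rho n j * phi n (M n) j k) ->
  (forall k, conv (fun n => rho n k) (r k)) ->
  exists g, (forall N, conv_upto N M (Ms g)) /\
    fps_comp r (fps_X * (1 + Ms g)) = Ms g.
Proof.
move=> M0 E cr.
have C k g : conv_upto k M (Ms g) ->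
    conv (fun n => M n k.+1) (fps_comp r (fps_X * (1 + Ms g)) k.+1).
  move=> Mg; apply: conv_near.
    apply: (@conv_sum _ _ _ (fun (j : 'I_k.+2) n => rho n j * phi n (M n) j k.+1)) => j.
    by apply: convM; [exact: cr | exact: (conv_upto_phi _ Mg (leqnn _))].
  by exists 1%N => n n0; rewrite (E n k.+1 k.+1).
have [|g Mg] := conv_upto_exists M0; first by move=> k g /C ?; eexists; eassumption.
exists g; split=> //; apply: fps_ext => -[|k].
  rewrite fps_comp0; apply: (conv_unique (cr 0%N)).
  apply: (conv_near (Mg 0%N 0%N (leqnn _))); exists 1%N => n n0.
  by rewrite (E n 0%N 0%N n0 (leqnn _)) big_ord1 mulr1.
by apply: (conv_unique (C k g (Mg k))); apply: Mg (leqnn k.+1).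
Qed.

(** In [fps_comp] the summation bound varies with the degree; as f^j starts in degree j, one bound N
    serves all degrees up to N. *)
Lemma fps_coef_mul_comp N (h s f : fps K) k : f 0%N = 0 -> (k <= N)%N ->
  (h * fps_comp s f) k = \sum_(j < N.+1) s j * (h * f ^+ j) k.
Proof.
move=> f0 kN; pose S : fps K := \sum_(j < N.+1) fps_const (s j) * f ^+ j.
transitivity ((h * S) k).
  rewrite !fps_coefM; apply: eq_bigr => i _; congr (_ * _).
  have ikN : (k - i < N.+1)%N by rewrite ltnS (leq_trans (leq_subr _ _)).
  rewrite /S fps_coef_sum [LHS]/= (big_ord_widen N.+1 (fun j => s j * (f ^+ j) (k - i)%N)) //.
  rewrite big_mkcond; apply: eq_bigr => j _; rewrite fps_coefCM ltnS.
  by case: leqP => // ij; rewrite fps_exp0 // mulr0.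
rewrite /S mulr_sumr fps_coef_sum; apply: eq_bigr => j _.
by rewrite [h * (_ * _)]mulrCA fps_coefCM.
Qed.

Lemma wop_small n (M f : fps K) k : (forall i, (i <= k)%N -> f i = 0) ->
  wop n M f k = 0.
Proof.
move=> f0; rewrite !(fps_coefD, fps_coefN) fps_coefCM fps_coef_theta f0 //.
rewrite fps_coefM big1 => [|i _]; first by rewrite !mulr0 !subr0.
by rewrite f0 ?mulr0 // leq_subr.
Qed.

(** The Newton coefficients solve a triangular system whose k-th pivot [c n k k] tends to (- a_1)^k.
    This is where a nonzero first moment enters. *)
Lemma ratios_conv M P (a : nat -> K) (s : fps K) :
  (forall n, (0 < n)%N -> logd n (P n) (M n)) ->
  (forall N, conv_upto N M (Ms a)) -> a 1%N != 0 -> is_inv_Stransform a s ->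
  exists tau : nat -> nat -> K, (forall k, conv (tau^~ k) (s k)) /\
    forall N, exists n0, forall n, (n0 <= n)%N -> forall k, (k <= N)%N ->
      M n k.+1 = \sum_(j < N.+1) tau n j * wop n (M n) (ffop n (M n) j 1) k.
Proof.
move=> PM Ma a1 sE; pose c n j k := wop n (M n) (ffop n (M n) j 1) k.
pose b j k := ((1 + Ms a) * (- Ms a) ^+ j) k.
have cb j k : conv (fun n => c n j k) (b j k).
  have := conv_upto_wop (Ma k) (conv_upto_ffop j (Ma k) (@conv_upto_cst k 1)).
  by move/(_ k (leqnn k)); rewrite mulr1.
have bk k : b k k != 0.
  rewrite /b fps_coefM big_ord_recl big1 ?addr0 => [|i _].
    by rewrite subn0 fps_exp_diag ?fps_coefN ?oppr0 // fps_coefD addr0 mul1r expf_neq0 // oppr_eq0.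
  by rewrite fps_exp0 ?mulr0 ?fps_coefN ?oppr0 // lift0 ltn_subrL (leq_trans _ (ltn_ord i)).
have aE k : Ms a k.+1 = \sum_(j < k.+1) s j * b j k.
  rewrite [in LHS]sE -mulrA fps_coefXM.
  by rewrite (@fps_coef_mul_comp k) // fps_coefN oppr0.
(* A zero pivot makes the quotient 0 by convention; the expansion is therefore claimed only once the
   pivots up to N are nonzero. *)
have /choice[tau tauE] : forall n, exists t : nat -> K, forall k,
    t k = (M n k.+1 - \sum_(j < k) t j * c n j k) / c n k k.
  move=> n; have [|t tE] := @strong_rec K 0 (fun k t =>
    (M n k.+1 - \sum_(j < k) t j * c n j k) / c n k k); last by exists t.
  by move=> k f g fg; congr ((_ - _) / _); apply: eq_bigr => i _; rewrite fg.
exists tau; split.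
  elim/ltn_ind => k IHk.
  have -> : s k = (Ms a k.+1 - \sum_(j < k) s j * b j k) / b k k.
    by rewrite aE big_ord_recr /= addrC addrK mulfK.
  apply: conv_near.
    apply: convM (convV (bk k) (cb k k)).
    apply: convD (Ma k.+1 k.+1 (leqnn _)) (convN _).
    apply: (@conv_sum _ _ _ (fun (j : 'I_k) n => tau n j * c n j k)) => j.
    by apply: convM; [exact: IHk | exact: cb].
  by exists 0%N => n _; rewrite [in RHS]tauE.
move=> N; have [n0 H] := eventually_upto (fun k => conv_neq0 (bk k) (cb k k)) N.
exists (maxn 1 n0) => n; rewrite geq_max => /andP[n1 nn0] k kN.
transitivity (\sum_(j < k.+1) tau n j * c n j k).
  rewrite big_ord_recr /= [tau n k]tauE divfK; last exact: H.
  by rewrite addrC subrK.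
rewrite (big_ord_widen N.+1 (fun j => tau n j * c n j k)) // big_mkcond.
apply: eq_bigr => j _; case: ltnP => // kj; rewrite wop_small ?mulr0 // => i ik.
exact: (ffop_small _ n1 (PM n n1) (leq_ltn_trans ik kj)).
Qed.

(** The composed operators tend to products of powers of - M, so the double sum tends to s(- M) t(-
    M), which is the composite of s t with - M. *)
Lemma moments_conv_of_ratios M (tau tau' : nat -> nat -> K) (s t : fps K) :
  (forall n, (0 < n)%N -> M n 0%N = 0) ->
  (forall k, conv (tau^~ k) (s k)) -> (forall k, conv (tau'^~ k) (t k)) ->
  (forall N, exists n0, forall n, (n0 <= n)%N -> forall k, (k <= N)%N ->
      M n k.+1 = \sum_(i < N.+1) \sum_(j < N.+1)
        tau n i * tau' n j * wop n (M n) (ffop n (M n) i (ffop n (M n) j 1)) k) ->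
  exists g, (forall N, conv_upto N M (Ms g)) /\ is_inv_Stransform g (s * t).
Proof.
move=> M0 cs ct E.
have C k g : conv_upto k M (Ms g) -> conv (fun n => M n k.+1)
   ((fps_X * (1 + Ms g) * fps_comp (s * t) (- Ms g)) k.+1).
  move=> Mg; have f0 : (- Ms g) 0%N = 0 by rewrite fps_coefN oppr0.
  have -> : (fps_X * (1 + Ms g) * fps_comp (s * t) (- Ms g)) k.+1 =
      \sum_(i < k.+1) \sum_(j < k.+1)
       s i * t j * ((1 + Ms g) * ((- Ms g) ^+ i * ((- Ms g) ^+ j * 1))) k.
    rewrite -mulrA fps_coefXM fps_compM // mulrCA mulrC.
    rewrite (@fps_coef_mul_comp k) //; apply: eq_bigr => i _.
    rewrite [_ * _ * _ ^+ _]mulrAC (@fps_coef_mul_comp k) // mulr_sumr; apply: eq_bigr => j _.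
    by rewrite mulr1 !mulrA.
  apply: conv_near.
    apply: (@conv_sum _ _ _ (fun (i : 'I_k.+1) n => \sum_(j < k.+1)
      tau n i * tau' n j * wop n (M n) (ffop n (M n) i (ffop n (M n) j 1)) k)) => i.
    apply: (@conv_sum _ _ _ (fun (j : 'I_k.+1) n =>
      tau n i * tau' n j * wop n (M n) (ffop n (M n) i (ffop n (M n) j 1)) k)) => j.
    apply: convM; first by apply: convM; [exact: cs | exact: ct].
    apply: (conv_upto_wop Mg _ (leqnn k)); apply: conv_upto_ffop => //.
    by apply: conv_upto_ffop => //; apply: conv_upto_cst.
  by have [n0 H] := E k; exists n0 => n nn0; rewrite (H n nn0 k).
have [|g Mg] := conv_upto_exists M0; first by move=> k g /C ?; eexists; eassumption.
exists g; split=> //; apply: fps_ext => -[|k]; first by rewrite -mulrA fps_coefXM.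
by apply: (conv_unique _ (C k g (Mg k))); apply: Mg (leqnn k.+1).
Qed.

End SeriesConvergence.

(** * Moments of the multiplicative convolution *)

Section MultiplicativeConvolution.
Variable K : numFieldType.
Hypothesis conv_invn : conv (fun n => n%:R^-1 : K) 0.
Local Notation Ms := moment_series.

(** The relation is stated for series because the perturbed ones below need not come from
    polynomials of degree n. *)
Definition mul_rel n (P P' Q : fps K) := forall k, (k <= n)%N ->
  Q k * 'C(n, k)%:R = (-1) ^+ k * P k * P' k.

(** Consecutive binomials have ratio (n - k)/(k + 1), which absorbs one of the two such factors
    coming from [P] and [P']. *)
Lemma mul_rel_ratio n (P P' Q : fps K) (T T' : K) k : (k < n)%N ->
  mul_rel n P P' Q ->
  k.+1%:R * P k.+1 = - ((n%:R - k%:R) * T * P k) ->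
  k.+1%:R * P' k.+1 = - ((n%:R - k%:R) * T' * P' k) ->
  k.+1%:R * Q k.+1 = - ((n%:R - k%:R) * T * T' * Q k).
Proof.
move=> kn QE PT PT'.
have C1 : k.+1%:R * 'C(n, k.+1)%:R = (n%:R - k%:R) * 'C(n, k)%:R :> K.
  by rewrite -natrM mul_bin_left natrM natrB // ltnW.
have D0 : k.+1%:R * 'C(n, k.+1)%:R != 0 :> K.
  by rewrite -natrM natr_neq0 // muln_gt0 bin_gt0.
apply: (mulIf D0).
transitivity ((k.+1%:R * k.+1%:R) * (Q k.+1 * 'C(n, k.+1)%:R)); first by ring.
rewrite QE // exprS.
transitivity (- (-1) ^+ k * (k.+1%:R * P k.+1) * (k.+1%:R * P' k.+1)); first by ring.
rewrite PT PT' C1.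
transitivity (- ((n%:R - k%:R) ^+ 2 * T * T' * ((-1) ^+ k * P k * P' k))); first by ring.
by rewrite -QE ?(ltnW kn) //; ring.
Qed.

Lemma mul_moments_conv_nondegenerate (P P' Q M M' Mu : nat -> fps K) (a b : nat -> K) :
  (forall n, (0 < n)%N -> logd n (P n) (M n)) ->
  (forall n, (0 < n)%N -> logd n (P' n) (M' n)) ->
  (forall n, (0 < n)%N -> logd n (Q n) (Mu n)) ->
  (forall n, (0 < n)%N -> mul_rel n (P n) (P' n) (Q n)) ->
  (forall N, conv_upto N M (Ms a)) -> (forall N, conv_upto N M' (Ms b)) ->
  a 1%N != 0 -> b 1%N != 0 ->
  exists c, [/\ forall N, conv_upto N Mu (Ms c), c 1%N != 0 &
    Stransform c = Stransform a * Stransform b].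
Proof.
move=> PM PM' QM rel Ma Mb a1 b1.
have [s sE] := inv_Stransform_exists a1; have [t tE] := inv_Stransform_exists b1.
have [tau [ctau tauE]] := ratios_conv conv_invn PM Ma a1 sE.
have [tau' [ctau' tauE']] := ratios_conv conv_invn PM' Mb b1 tE.
have [||c [Mc cE]] := moments_conv_of_ratios conv_invn _ ctau ctau' (M := Mu).
- by move=> n n0; apply: logd_coef0 (QM n n0).
- move=> N; have [n1 H1] := tauE N; have [n2 H2] := tauE' N.
  (* Taking n > N ensures k < n, as [mul_rel_ratio] requires. *)
  exists (maxn N.+1 (maxn n1 n2)) => n; rewrite !geq_max => /and3P[Nn n1n n2n] k kN.
  have n0 : (0 < n)%N by apply: leq_ltn_trans Nn.
  apply: (logd_product_expansion n0 (QM n n0) _ kN) => {}k {}kN.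
  apply: (mul_rel_ratio (leq_ltn_trans kN Nn) (rel n n0)).
    exact: (logd_ratio_of_expansion n0 (PM n n0) (H1 n n1n)).
  exact: (logd_ratio_of_expansion n0 (PM' n n0) (H2 n n2n)).
have X0 : (- fps_X : fps K) 0%N = 0 by rewrite fps_coefN oppr0.
(* The linear coefficient of the equation is m_1 = r(0); hence c_1 = a_1 b_1. *)
have first_coef m (r : fps K) : is_inv_Stransform m r -> m 1%N = r 0%N.
  move/(congr1 (fun f : fps K => f 1%N)); rewrite /= => E.
  rewrite [LHS]E -[LHS]/((fps_X * (1 + Ms m) * fps_comp r (- Ms m)) 1%N).
  by rewrite -mulrA fps_coefXM fps_coefM0 fps_comp0 fps_coefD addr0 mul1r.
have c1 : c 1%N != 0.
  rewrite (first_coef _ _ cE) fps_coefM0 -(first_coef _ _ sE) -(first_coef _ _ tE).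
  exact: mulf_neq0.
exists c; split=> //.
have Ec := inv_StransformP c1 cE; have Ea := inv_StransformP a1 sE.
have Eb := inv_StransformP b1 tE; rewrite fps_compM // in Ec.
move: (Stransform a) (Stransform b) (Stransform c) Ea Eb Ec => x y z Ea Eb Ec.
transitivity (z * (x * fps_comp s (- fps_X)) * (y * fps_comp t (- fps_X))).
  by rewrite Ea Eb !mulr1.
transitivity (x * y * (z * (fps_comp s (- fps_X) * fps_comp t (- fps_X)))); first by ring.
by rewrite Ec mulr1.
Qed.

(** The degree bound is recorded because [conv_horner0] needs one that is uniform in n. *)
Definition poly_fun d (f : K -> K) :=
  exists2 G : {poly K}, (size G <= d.+1)%N & forall t, f t = G.[t].

Lemma poly_fun_cst d c : poly_fun d (fun=> c).
Proof.
by exists c%:P => [|t]; rewrite ?hornerC // (leq_trans (size_polyC_leq1 _)).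
Qed.

Lemma poly_funD d f g : poly_fun d f -> poly_fun d g ->
  poly_fun d (fun t => f t + g t).
Proof.
move=> [F sF fF] [G sG gG]; exists (F + G) => [|t]; last by rewrite hornerD fF gG.
by rewrite (leq_trans (size_polyD _ _)) // geq_max sF.
Qed.

Lemma poly_funM d e f g : poly_fun d f -> poly_fun e g ->
  poly_fun (d + e) (fun t => f t * g t).
Proof.
move=> [F sF fF] [G sG gG]; exists (F * G) => [|t]; last by rewrite hornerM fF gG.
rewrite (leq_trans (size_polyMleq _ _)) // -subn1 leq_subLR add1n -addSn -addnS.
exact: leq_add.
Qed.

Lemma poly_fun_sum d k (f : 'I_k -> K -> K) : (forall i, poly_fun d (f i)) ->
  poly_fun d (fun t => \sum_(i < k) f i t).
Proof.
move=> pf; elim: k f pf => [|k IHk] f pf.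
  have [G sG GE] := poly_fun_cst d 0; exists G => // t; by rewrite big_ord0 -GE.
have [G sG GE] := poly_funD (IHk _ (fun i => pf (widen_ord (leqnSn k) i))) (pf ord_max).
by exists G => // t; rewrite big_ord_recr -GE.
Qed.

Lemma poly_fun_scale d c f : poly_fun d f -> poly_fun d (fun t => c * f t).
Proof. by move=> pf; have := poly_funM (poly_fun_cst 0 c) pf. Qed.

Lemma poly_fun_ext d f g : (forall t, g t = f t) -> poly_fun d f -> poly_fun d g.
Proof. by move=> fg [G sG fG]; exists G => // t; rewrite fg. Qed.

(** Newton's identities give P_k degree at most k in t, since only the first moment carries t. Q_k
    is a multiple of P_k independent of t, and Newton's identities lead back to the moments. *)
Lemma mul_moments_poly_fun n (M P' : fps K) (P Q Mu : K -> fps K) : (0 < n)%N ->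
  M 0%N = 0 ->
  (forall t, logd n (P t) (M + fps_const t * fps_X)) ->
  (forall t, logd n (Q t) (Mu t)) ->
  (forall t, mul_rel n (P t) P' (Q t)) ->
  forall k, (k <= n)%N -> poly_fun k (fun t => Mu t k).
Proof.
move=> n0 M0 PM QM rel.
have pP k : poly_fun k (fun t => P t k).
  elim/ltn_ind: k => -[_|k IHk].
    by apply: poly_fun_ext (poly_fun_cst 0 1) => t; rewrite (PM t).1.
  have E t : P t k.+1 = - (n%:R / k.+1%:R) * \sum_(i < k.+1)
      (M i.+1 + t * (i == 0%N :> nat)%:R) * P t (k - i)%N.
    rewrite (logd_rec k (PM t)); last by rewrite fps_coefD fps_coefCM M0 mulr0 addr0.
    rewrite mulNr; congr (- (_ * _)); apply: eq_bigr => i _.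
    by rewrite fps_coefD fps_coefCM.
  apply: (poly_fun_ext E); apply: poly_fun_scale; apply: poly_fun_sum => i.
  have ik : (k - i <= k)%N by rewrite leq_subr.
  have pt : poly_fun 1 (fun t => M i.+1 + t * (i == 0%N :> nat)%:R).
    apply: poly_funD (poly_fun_cst 1 _) _.
    exists (((i == 0%N :> nat)%:R)%:P * 'X) => [|t].
      by rewrite mul_polyC (leq_trans (size_scale_leq _ _)) ?size_polyX.
    by rewrite hornerM hornerC hornerX mulrC.
  have [G sG GE] := poly_funM pt (IHk _ (ik : (k - i < k.+1)%N)).
  by exists G => //; rewrite (leq_trans sG) // !ltnS add1n ltnS.
have pQ k : (k <= n)%N -> poly_fun k (fun t => Q t k).
  move=> kn; have E t : Q t k = ('C(n, k)%:R^-1 * (-1) ^+ k * P' k) * P t k.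
    have b0 : 'C(n, k)%:R != 0 :> K by rewrite natr_neq0 // bin_gt0.
    by apply: (mulIf b0); rewrite rel //; field.
  by apply: (poly_fun_ext E); apply: poly_fun_scale.
elim/ltn_ind => -[_ _|k IHk kn].
  by apply: poly_fun_ext (poly_fun_cst 0 0) => t; rewrite (logd_coef0 n0 (QM t)).
(* Newton's recursion is solved for its last term, where the constant coefficient of Q is 1. *)
have E t : Mu t k.+1 = - (k.+1%:R / n%:R) * Q t k.+1 +
    - 1 * \sum_(i < k) Mu t i.+1 * Q t (k - i)%N.
  rewrite (logd_rec k (QM t) (logd_coef0 n0 (QM t))) big_ord_recr /= subnn (QM t).1.
  have nz := natr_neq0 K n0; have kz := natr_neq0 K (ltn0Sn k).
  move: (\sum_(i < k) _) (Mu t k.+1) => S x.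
  by move: n%:R k.+1%:R nz kz => y z nz kz; field; rewrite nz kz.
apply: (poly_fun_ext E); apply: poly_funD; first by apply: poly_fun_scale; apply: pQ.
apply: poly_fun_scale; apply: poly_fun_sum => i.
have ik : (i.+1 + (k - i) = k.+1)%N by rewrite addSn subnKC // ltnW.
rewrite -{1}ik; apply: poly_funM.
  by apply: IHk; rewrite ?ltnS // (leq_trans _ kn) // ltnS ltnW.
by apply: pQ; rewrite (leq_trans (leq_subr _ _)) // ltnW.
Qed.

(* Shifting the first moments m_1(p_n) by t makes the limit nonzero for every
   t <> 0, and the moments of the convolution are polynomials in t. *)
Lemma mul_moments_conv_perturb (P' : nat -> fps K) :
  (forall n, (0 < n)%N -> P' n 0%N = 1) ->
  (forall (P Q M Mu : nat -> fps K) (a : nat -> K),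
    (forall n, (0 < n)%N -> logd n (P n) (M n)) ->
    (forall n, (0 < n)%N -> logd n (Q n) (Mu n)) ->
    (forall n, (0 < n)%N -> mul_rel n (P n) (P' n) (Q n)) ->
    (forall N, conv_upto N M (Ms a)) -> a 1%N != 0 ->
    forall k, exists l, conv (fun n => Mu n k) l) ->
  forall (P Q M Mu : nat -> fps K) (a : nat -> K),
    (forall n, (0 < n)%N -> logd n (P n) (M n)) ->
    (forall n, (0 < n)%N -> logd n (Q n) (Mu n)) ->
    (forall n, (0 < n)%N -> mul_rel n (P n) (P' n) (Q n)) ->
    (forall N, conv_upto N M (Ms a)) ->
    forall k, exists l, conv (fun n => Mu n k) l.
Proof.
move=> P'0 H P Q M Mu a PM QM rel Ma k.
have [a1|] := eqVneq (a 1%N) 0; last by move=> a1; apply: (H P Q M Mu a).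
(* For each n and t the triple holds the shifted series, its convolution with [P'] and the moments
   of the latter. At t = 0 the given data are kept, so evaluation at 0 returns [Mu]. *)
have /choice[F FE] : forall nt : nat * K, exists F : fps K * fps K * fps K,
    (0 < nt.1)%N -> [/\ logd nt.1 F.1.1 (M nt.1 + fps_const nt.2 * fps_X),
      logd nt.1 F.1.2 F.2, mul_rel nt.1 F.1.1 (P' nt.1) F.1.2 &
      nt.2 = 0 -> F.2 = Mu nt.1].
  move=> [n t] /=; have [->|n0] := posnP n; first by exists (0, 0, 0).
  have [t0|t0] := eqVneq t 0.
    exists (P n, Q n, Mu n) => _; split=> //=; [|exact: QM|exact: rel].
    have -> : M n + fps_const t * fps_X = M n; last exact: PM.
    by apply: fps_ext => i; rewrite fps_coefD fps_coefCM t0 mul0r addr0.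
  have [|Pt PtM] := @logd_exists_exp K n (M n + fps_const t * fps_X).
    by rewrite fps_coefD fps_coefCM mulr0 addr0 (logd_coef0 n0 (PM n n0)).
  (* Above degree n the binomial vanishes and the coefficient is 0 by the division convention. *)
  pose Qt := Fps (fun i => (-1) ^+ i * Pt i * P' n i / 'C(n, i)%:R).
  have [|Mt QtM] := @logd_exists_log K n Qt n0.
    by rewrite /= bin0 PtM.1 P'0 // divr1 !mulr1.
  exists (Pt, Qt, Mt) => _; split=> //= [i ni|/eqP]; last by rewrite (negbTE t0).
  by rewrite divfK // natr_neq0 // bin_gt0.
have pMu n : (0 < n)%N -> (k <= n)%N -> poly_fun k (fun t => (F (n, t)).2 k).
  move=> n0 kn.
  apply: (@mul_moments_poly_fun n (M n) (P' n) (fun t => (F (n, t)).1.1)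
    (fun t => (F (n, t)).1.2)) => //; first exact: logd_coef0 n0 (PM n n0).
  - by move=> t; case: (FE (n, t) n0).
  - by move=> t; case: (FE (n, t) n0).
  - by move=> t; case: (FE (n, t) n0).
(* For small n the zero polynomial is taken, because [conv_horner0] asks for the size bound at every
   n. *)
have /choice[G GE] : forall n, exists G : {poly K}, (size G <= k.+1)%N /\
    ((maxn 1 k <= n)%N -> forall t, (F (n, t)).2 k = G.[t]).
  move=> n; case: (leqP (maxn 1 k) n) => kn; last by exists 0; rewrite size_poly0.
  move: (kn); rewrite geq_max => /andP[n0 kn'].
  by have [G sG GE] := pMu n n0 kn'; exists G.
have [n|t t0|l cl] := @conv_horner0 K G k.+1; first exact: (GE n).1.
  have [|||||l cl] := H (fun n => (F (n, t)).1.1) (fun n => (F (n, t)).1.2)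
      (fun n => M n + fps_const t * fps_X) (fun n => (F (n, t)).2)
      (fun i => a i + t * (i == 1%N)%:R) _ _ _ _ _ k.
  - by move=> n n0; case: (FE (n, t) n0).
  - by move=> n n0; case: (FE (n, t) n0).
  - by move=> n n0; case: (FE (n, t) n0).
  - move=> N i iN.
    have -> : Ms (fun i => a i + t * (i == 1%N)%:R) i = (Ms a + fps_const t * fps_X) i.
      by case: i {iN} => [|i]; rewrite fps_coefD fps_coefCM //= mulr0 addr0.
    by apply: (conv_uptoD (Ma N) _ iN); apply: conv_upto_cst.
  - by rewrite a1 add0r mulr1.
  exists l; apply: (conv_near cl); exists (maxn 1 k) => n kn.
  exact: (GE n).2.
exists l; apply: (conv_near cl); exists (maxn 1 k) => n kn.
rewrite -(GE n).2 //; move: kn; rewrite geq_max => /andP[n0 _].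
by case: (FE (n, 0) n0) => _ _ _ /= ->.
Qed.

(** The perturbation is applied twice, once to each factor, the roles being exchanged by
    commutativity of the relation. *)
Lemma mul_moments_conv (P P' Q M M' Mu : nat -> fps K) (a b : nat -> K) :
  (forall n, (0 < n)%N -> logd n (P n) (M n)) ->
  (forall n, (0 < n)%N -> logd n (P' n) (M' n)) ->
  (forall n, (0 < n)%N -> logd n (Q n) (Mu n)) ->
  (forall n, (0 < n)%N -> mul_rel n (P n) (P' n) (Q n)) ->
  (forall N, conv_upto N M (Ms a)) -> (forall N, conv_upto N M' (Ms b)) ->
  exists c, (forall N, conv_upto N Mu (Ms c)) /\
    (a 1%N != 0 -> b 1%N != 0 ->
      c 1%N != 0 /\ Stransform c = Stransform a * Stransform b).
Proof.
move=> PM PM' QM rel Ma Mb.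
have relC n (R R' S : fps K) : mul_rel n R R' S -> mul_rel n R' R S.
  by move=> E k kn; rewrite E // mulrAC.
have cMu : forall k, exists l, conv (fun n => Mu n k) l.
  apply: (mul_moments_conv_perturb _ _ PM QM rel Ma); first by move=> n /PM'[].
  move=> P1 Q1 M1 Mu1 a' PM1 QM1 rel1 Ma' a1.
  have rel1C n : (0 < n)%N -> mul_rel n (P' n) (P1 n) (Q1 n).
    by move=> n0; apply: relC; apply: rel1.
  apply: (mul_moments_conv_perturb _ _ PM' QM1 rel1C Mb); first by move=> n /PM1[].
  move=> P2 Q2 M2 Mu2 b' PM2 QM2 rel2 Mb' b1 k.
  have [|c [Mc _ _]] := mul_moments_conv_nondegenerate PM1 PM2 QM2 _ Ma' Mb' a1 b1.
    by move=> n n0; apply: relC; apply: rel2.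
  by exists (Ms c k); apply: Mc (leqnn k).
have [c Mc] : exists c, forall N, conv_upto N Mu (Ms c).
  apply: conv_upto_exists => [n n0|k _ _]; [exact: logd_coef0 (QM n n0) | exact: cMu].
(* If both first moments are nonzero, the limits come from the nondegenerate case together with the
   S-transform; otherwise only convergence is claimed. *)
have [[a1 b1]|nab] := pselect (a 1%N != 0 /\ b 1%N != 0); last first.
  by exists c; split=> // a1 b1; case: nab.
have [d [Md d1 dE]] := mul_moments_conv_nondegenerate PM PM' QM rel Ma Mb a1 b1.
by exists d.
Qed.

End MultiplicativeConvolution.

(** * Moments of the additive convolution *)

Section AdditiveConvolution.
Variable K : numFieldType.
Hypothesis conv_invn : conv (fun n => n%:R^-1 : K) 0.
Local Notation Ms := moment_series.

(** The cumulants of the two factors converge to the coefficients of z R_a and z R_b. Their sums are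
    the cumulants of the convolution, and the limiting equation characterises its R-transform. *)
Lemma add_moments_conv (P P' Q A A' M M' Mu : nat -> fps K) (a b : nat -> K) :
  (forall n, (0 < n)%N -> logd n (P n) (M n)) ->
  (forall n, (0 < n)%N -> logd n (P' n) (M' n)) ->
  (forall n, (0 < n)%N -> logd n (Q n) (Mu n)) ->
  (forall n, (0 < n)%N -> forall k, P n k = A n k * ffac_ratio K n k) ->
  (forall n, (0 < n)%N -> forall k, P' n k = A' n k * ffac_ratio K n k) ->
  (forall n, (0 < n)%N -> forall k, Q n k = (A n * A' n) k * ffac_ratio K n k) ->
  (forall N, conv_upto N M (Ms a)) -> (forall N, conv_upto N M' (Ms b)) ->
  exists c, (forall N, conv_upto N Mu (Ms c)) /\
    Rtransform c = Rtransform a + Rtransform b.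
Proof.
move=> PM PM' QM PA PA' QA Ma Mb.
have A0 (S B m : fps K) n : logd n S m -> (forall k, S k = B k * ffac_ratio K n k) ->
    B 0%N = 1.
  by move=> [S0 _] /(_ 0%N); rewrite S0 /ffac_ratio big_ord0 mulr1.
have cum (S B m : nat -> fps K) : (forall n, (0 < n)%N -> logd n (S n) (m n)) ->
    (forall n, (0 < n)%N -> forall k, S n k = B n k * ffac_ratio K n k) ->
    exists rho, forall n, (0 < n)%N -> logd n (B n) (rho n).
  move=> Sm SB; suff /choice[rho rhoE] : forall n, exists r, (0 < n)%N -> logd n (B n) r.
    by exists rho.
  move=> n; have [->|n0] := posnP n; first by exists 0.
  have [r rE] := logd_exists_log n0 (A0 _ _ _ _ (Sm n n0) (SB n n0)).
  by exists r.
have [rho rhoE] := cum _ _ _ PM PA; have [rho' rhoE'] := cum _ _ _ PM' PA'.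
have M0 (S m : nat -> fps K) : (forall n, (0 < n)%N -> logd n (S n) (m n)) ->
    forall n, (0 < n)%N -> m n 0%N = 0.
  by move=> Sm n n0; apply: logd_coef0 (Sm n n0).
have crho := cumulants_conv conv_invn (M0 _ _ PM)
  (fun n N k n0 => moments_from_cumulants n0 (PM n n0) (rhoE n n0) (PA n n0)) Ma
  (fps_comp_Rtransform a).
have crho' := cumulants_conv conv_invn (M0 _ _ PM')
  (fun n N k n0 => moments_from_cumulants n0 (PM' n n0) (rhoE' n n0) (PA' n n0)) Mb
  (fps_comp_Rtransform b).
have [||c [Mc cE]] := moments_conv_of_cumulants conv_invn (M0 _ _ QM) (rho := fun n => rho n + rho' n)
  (r := fps_X * (Rtransform a + Rtransform b)).
- move=> n N k n0.
  apply: (moments_from_cumulants n0 (QM n n0) (logdM (rhoE n n0) (rhoE' n n0))).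
  exact: QA.
- by move=> k; rewrite mulrDr; apply: convD.
by exists c; split=> //; apply: Rtransform_unique.
Qed.

End AdditiveConvolution.

(** * Passage to complex polynomials *)

Lemma moment0 (C : numClosedFieldType) n (p : {poly C}) : (0 < n)%N ->
  size p = n.+1 -> moment p 0 = 1.
Proof.
move=> n0 sp; rewrite /moment (eq_bigr (fun=> 1)) // big_const_seq count_predT.
rewrite iter_addr_0 size_zeros -?size_poly_eq0 ?sp //=.
by rewrite mulVf // natr_neq0.
Qed.

(** A positive complex number is real, so the claim reduces to the Archimedean property of [R]. *)
Lemma conv_invn_complex (R : realType) : conv (fun n => n%:R^-1 : R[i]) 0.
Proof.
split; apply/(@cvgrPdist_lt _ R[i]^o) => -[a b]; rewrite ltcE /= => /andP[/eqP-> a0].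
exists (Num.bound a^-1).+1 => // n /= Nn; have n0 : (0 < n)%N by apply: leq_ltn_trans Nn.
rewrite sub0r normrN ger0_norm ?invr_ge0 ?ler0n //.
have -> : (n%:R^-1 : R[i]) = (n%:R^-1)%:C%C by rewrite rmorphV ?unitfE ?natr_neq0 ?rmorph_nat.
rewrite ltcR invf_plt ?posrE ?ltr0n //.
apply: (lt_trans (archi_boundP _)); first by rewrite invr_ge0 ltW.
by rewrite ltr_nat.
Qed.

Lemma conv_upto_moment (R : realType) (p : nat -> {poly R[i]}) (a : nat -> R[i]) :
  (forall k, moment (p n) k @[n --> \oo] --> (a k : R[i]^o)) ->
  forall N, conv_upto N (fun n => moment_series (moment (p n))) (moment_series a).
Proof. by move=> lim N [|k] _; [apply: conv_cst | split; apply: lim]. Qed.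

(** [moment_series] forgets the entry at 0, so [c 0] is arbitrary; it is replaced by 1, the zeroth
    moment for every n > 0. *)
Lemma moment_cvg_of_conv_upto (R : realType) (r : nat -> {poly R[i]})
    (c : nat -> R[i]) :
  (forall n, (0 < n)%N -> size (r n) = n.+1) ->
  (forall N, conv_upto N (fun n => moment_series (moment (r n))) (moment_series c)) ->
  exists2 g, moment_series g = moment_series c &
    forall k, moment (r n) k @[n --> \oo] --> (g k : R[i]^o).
Proof.
move=> sr Mc; exists (fun k => if k is 0 then 1 else c k).
  by apply: fps_ext => -[].
move=> [|k]; last exact: conv_cvg (Mc k.+1 k.+1 (leqnn _)).
apply: conv_cvg; apply: (conv_near (conv_cst 1)); exists 1%N => n n0.
by rewrite (moment0 n0 (sr n n0)).
Qed.

Local Open Scope complex_scope.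

Theorem theorem3p5 (R : realType) (p q : nat -> {poly R[i]})
  (alpha beta : nat -> R[i])
  (deg_p : forall n, (0 < n)%N -> size (p n) = n.+1)
  (deg_q : forall n, (0 < n)%N -> size (q n) = n.+1)
  (bounded_zeros : exists B : R, forall n, (0 < n)%N ->
     forall z : R[i], root (p n) z \/ root (q n) z -> `|z| <= B%:C)
  (lim_p : forall k, moment (p n) k @[n --> \oo] --> (alpha k : R[i]^o))
  (lim_q : forall k, moment (q n) k @[n --> \oo] --> (beta k : R[i]^o)) :
  (exists gamma : nat -> R[i],
     (forall k,
       moment (finfree_add n (p n) (q n)) k @[n --> \oo] --> (gamma k : R[i]^o)) /\
     Rtransform gamma = Rtransform alpha + Rtransform beta) /\
  (exists theta : nat -> R[i],
     (forall k,
       moment (finfree_mul n (p n) (q n)) k @[n --> \oo] --> (theta k : R[i]^o)) /\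
     (alpha 1%N != 0 -> beta 1%N != 0 ->
        theta 1%N != 0 /\
        Stransform theta = Stransform alpha * Stransform beta)).
Proof.
have invn := conv_invn_complex R.
have PM n (n0 : (0 < n)%N) := logd_rev_series n0 (deg_p n n0).
have PM' n (n0 : (0 < n)%N) := logd_rev_series n0 (deg_q n n0).
have Ma := conv_upto_moment lim_p; have Mb := conv_upto_moment lim_q.
have sadd n (n0 : (0 < n)%N) := size_finfree_add (deg_p n n0) (deg_q n n0).
have smul n (n0 : (0 < n)%N) := size_finfree_mul (deg_p n n0) (deg_q n n0).
split.
  have [c [Mc cE]] := add_moments_conv invn PM PM'
    (fun n n0 => logd_rev_series n0 (sadd n n0))
    (fun n n0 => rev_seriesE n0 (p n)) (fun n n0 => rev_seriesE n0 (q n))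
    (fun n n0 => rev_series_finfree_add n0 (deg_p n n0) (deg_q n n0)) Ma Mb.
  have [g gc gE] := moment_cvg_of_conv_upto sadd Mc; exists g; split; first exact: gE.
  (* The transform depends on the sequence only through its moment series, so it agrees for [g] and
     [c]. *)
  by rewrite -cE /Rtransform /is_Rtransform gc.
have [c [Mc cE]] := mul_moments_conv invn PM PM'
  (fun n n0 => logd_rev_series n0 (smul n n0))
  (fun n n0 => rev_series_finfree_mul (deg_p n n0) (deg_q n n0)) Ma Mb.
have [g gc gE] := moment_cvg_of_conv_upto smul Mc; exists g; split; first exact: gE.
move=> a1 b1.
have [c1 Sc] := cE a1 b1; split; last by rewrite -Sc /Stransform gc.
by have /= -> := congr1 (fun f : fps R[i] => f 1%N) gc.
Qed.
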